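(* Let $L$ be a language equipped with a permutation group $\Gamma_L$ where the arity of every function symbol is at most $1$ and let $\mathbf A$ be a finite $\Gamma_L$-structure. Let $L^0_{\mathcal F}$ be the set of all constant symbols (nullary function symbols) of $L$. Assume the following: (1) For every $g\in\Gamma_L$ and every $c\in L^0_{\mathcal F}$ it holds that $g(c)=c$. (2) $L^0_{\mathcal F}$ is finite. (3) For every $c\in L^0_{\mathcal F}$ it holds that $c_{\mathbf A}$ is a singleton. (4) For every $c\neq c'\in L^0_{\mathcal F}$ it holds that $c_{\mathbf A}\neq c'_{\mathbf A}$. (5) For every $c\in L^0_{\mathcal F}$ and for every unary function symbol $F\in L$ it holds that $F_{\mathbf A}(c_{\mathbf A})=\emptyset$. (6) $\mathbf A$ lies in a finite orbit of the action of $\Gamma_L$ by relabelling. Then there is a finite $\Gamma_L$-structure $\mathbf B$ which is an irreducible structure faithful coherent EPPA-witness for $\mathbf A$.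
   Context: Structures. A language $L$ consists of relation symbols $R$ (of arity $a(R)\ge 1$) and function symbols $F$ (of arity $a(F)\ge 0$; $F$ is unary if $a(F)=1$, and a constant symbol if $a(F)=0$). $L$ is equipped with a permutation group $\Gamma_L$ if $\Gamma_L$ is a group of permutations of $L$ mapping relation symbols to relation symbols and function symbols to function symbols and preserving arities. A $\Gamma_L$-structure $\mathbf A$ has a finite or countably infinite vertex set $A$, a relation $R_{\mathbf A}\subseteq A^{a(R)}$ for each relation symbol $R\in L$, and a function $F_{\mathbf A}\colon A^{a(F)}\to\mathcal P(A)$ (the power set of $A$) for each function symbol $F\in L$. It is finite if $A$ is finite. For a constant symbol $c$, $c_{\mathbf A}\subseteq A$ denotes the value of the nullary function on the empty tuple; if it is a singleton $\{x\}$, one writes $c_{\mathbf A}=x$. Maps. A homomorphism $f\colon\mathbf A\to\mathbf B$ is a pair $f=(f_L,f_A)$ with $f_L\in\Gamma_L$ and $f_A\colon A\to B$ such that, for all $R,F\in L$ and all tuples $\bar x$, $\bar x\in R_{\mathbf A}$ implies $f_A(\bar x)\in f_L(R)_{\mathbf B}$, and $f_A(F_{\mathbf A}(\bar x))\subseteq f_L(F)_{\mathbf B}(f_A(\bar x))$. It is an embedding if $f_A$ is injective, the implication is an equivalence and the inclusion is an equality. An isomorphism is an embedding with $f_A$ bijective; an automorphism is an isomorphism of a structure to itself. Maps compose componentwise (language parts and vertex parts). $\mathbf A$ is a substructure of $\mathbf B$ if $A\subseteq B$ and the pair ($\mathrm{id}_L$, inclusion) is an embedding (in particular substructures contain the values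 of all constants). For an embedding $f\colon\mathbf A\to\mathbf B$, $f(\mathbf A)$ is the substructure of $\mathbf B$ with vertex set $f_A(A)$; for a vertex set $X$, $f(X)=f_A(X)$. Relabelling. For $g\in\Gamma_L$, $g\mathbf A$ is the $\Gamma_L$-structure on the vertex set $A$ with $R_{g\mathbf A}=(g^{-1}(R))_{\mathbf A}$ and $F_{g\mathbf A}=(g^{-1}(F))_{\mathbf A}$; this defines the action of $\Gamma_L$ by relabelling. Irreducibility. Given embeddings $\alpha_i\colon\mathbf A\to\mathbf B_i$ ($i=1,2$), an amalgamation of $\mathbf B_1,\mathbf B_2$ over $\mathbf A$ with respect to $\alpha_1,\alpha_2$ is a structure $\mathbf C$ with embeddings $\beta_i\colon\mathbf B_i\to\mathbf C$ such that $\beta_1\alpha_1=\beta_2\alpha_2$ (including language parts). It is strong if $\beta_1(B_1)\cap\beta_2(B_2)=\beta_1\alpha_1(A)$. A strong amalgamation is free if $C=\beta_1(B_1)\cup\beta_2(B_2)$ and whenever a tuple $\bar x$ of vertices of $\mathbf C$ contains vertices of both $\beta_1(B_1\setminus\alpha_1(A))$ and $\beta_2(B_2\setminus\alpha_2(A))$, then $\bar x$ is in no relation of $\mathbf C$ and $F_{\mathbf C}(\bar x)=\emptyset$ for every $F\in L$ of the corresponding arity. A structure is irreducible if it is not a free amalgamation of two of its proper substructures (over a common substructure, with respect to inclusions). EPPA. A partial automorphism of $\mathbf A$ is an isomorphism $f$ between substructures of $\mathbf A$; its language part $f_L\in\Gamma_L$ is part of the data, and $\mathrm{dom}(f)$,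 $\mathrm{range}(f)$ refer to its vertex part. An automorphism $\theta$ extends $f$ if $\theta$ has the same language part as $f$ and its vertex part extends that of $f$. A finite $\mathbf B$ is an EPPA-witness for a finite $\mathbf A$ if there is an embedding $\psi\colon\mathbf A\to\mathbf B$ such that every partial automorphism of $\psi(\mathbf A)$ extends to an automorphism of $\mathbf B$. It is coherent if moreover (for this $\psi$) one can choose, for each partial automorphism $f$ of $\psi(\mathbf A)$, an automorphism $\hat f$ of $\mathbf B$ extending $f$ so that $\widehat{gf}=\hat g\hat f$ whenever $\mathrm{range}(f)=\mathrm{dom}(g)$. It is irreducible structure faithful if (for this $\psi$) for every irreducible substructure $\mathbf C$ of $\mathbf B$ there is an automorphism $g$ of $\mathbf B$ with $g(C)\subseteq\psi(A)$. *)

(* Defs.v *)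
From HB Require Import structures.
From mathcomp Require Import all_boot.
From mathcomp Require Import boolp classical_sets functions cardinality.

Set Implicit Arguments.
Unset Strict Implicit.
Unset Printing Implicit Defensive.

Local Open Scope classical_set_scope.

(* Symbols are sorted by arity: [rel_symb n] and [fun_symb n] are the relation
   and function symbols of arity n, so that a permutation of the language
   preserving kinds and arities is a family of permutations of these types. *)
Record language := Language {
  rel_symb : nat -> Type;
  fun_symb : nat -> Type;
  rel_symb_gt0 : forall n, rel_symb n -> (0 < n)%N
}.

Record permutation (T : Type) := Permutation {
  perm_fun :> T -> T;
  perm_inv : T -> T;
  perm_funK : cancel perm_fun perm_inv;
  perm_invK : cancel perm_inv perm_fun
}.

Definition permutation_id (T : Type) : permutation T :=
  @Permutation T id id (fun=> erefl) (fun=> erefl).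

Definition permutation_comp (T : Type) (g f : permutation T) : permutation T :=
  Permutation (can_comp (@perm_funK T g) (@perm_funK T f))
              (can_comp (@perm_invK T f) (@perm_invK T g)).

Definition permutation_inv (T : Type) (f : permutation T) : permutation T :=
  Permutation (@perm_invK T f) (@perm_funK T f).

Lemma permutation_ext (T : Type) (f g : permutation T) : f =1 g -> f = g.
Proof.
case: f g => [f f' fK f'K] [g g' gK g'K] /= /funext fg; subst g.
have f'g' : f' = g' by apply/funext => x; rewrite -[LHS]gK f'K.
by subst g'; congr Permutation; apply: Prop_irrelevance.
Qed.

Record lang_perm (L : language) := LangPerm {
  on_rel : forall n, permutation (rel_symb L n);
  on_fun : forall n, permutation (fun_symb L n)
}.

Definition lang_id (L : language) : lang_perm L :=
  LangPerm (fun n => permutation_id (rel_symb L n))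
           (fun n => permutation_id (fun_symb L n)).

Definition lang_comp (L : language) (g f : lang_perm L) : lang_perm L :=
  LangPerm (fun n => permutation_comp (on_rel g n) (on_rel f n))
           (fun n => permutation_comp (on_fun g n) (on_fun f n)).

Definition lang_inv (L : language) (f : lang_perm L) : lang_perm L :=
  LangPerm (fun n => permutation_inv (on_rel f n))
           (fun n => permutation_inv (on_fun f n)).

Record perm_group (L : language) := PermGroup {
  perm_group_set :> lang_perm L -> Prop;
  perm_group_id : perm_group_set (lang_id L);
  perm_group_comp : forall g f,
    perm_group_set g -> perm_group_set f -> perm_group_set (lang_comp g f);
  perm_group_inv : forall f, perm_group_set f -> perm_group_set (lang_inv f)
}.

Record interpretation (L : language) (V : Type) := Interpretation {
  rel_int : forall n, rel_symb L n -> set (n.-tuple V);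
  fun_int : forall n, fun_symb L n -> n.-tuple V -> set V
}.

(* The group of permutations of L plays no role in what a structure is, only
   in which maps between structures are allowed. A [countType] is finite or
   countably infinite. *)
Record structure (L : language) := Structure {
  vertex :> countType;
  interp : interpretation L vertex
}.

Definition rel_of (L : language) (A : structure L) (n : nat)
  (R : rel_symb L n) : set (n.-tuple A) := rel_int (interp A) R.

Definition fun_of (L : language) (A : structure L) (n : nat)
  (F : fun_symb L n) : n.-tuple A -> set A := @fun_int _ _ (interp A) n F.

Definition finite_structure (L : language) (A : structure L) : Prop :=
  finite_set [set: A].

Definition relabel (L : language) (V : Type) (g : lang_perm L)
    (S : interpretation L V) : interpretation L V :=
  Interpretation (fun n R => rel_int S (on_rel (lang_inv g) n R))
                 (fun n F => @fun_int _ _ S n (on_fun (lang_inv g) n F)).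

(* All structures in the orbit of A share the vertex set of A, so the orbit is
   a set of interpretations on that vertex set. *)
Definition relabel_orbit (L : language) (Gam : perm_group L)
    (A : structure L) : set (interpretation L A) :=
  [set relabel g (interp A) | g in [set g | Gam g]].

Arguments relabel_orbit {L} Gam A.

Record lmap (L : language) (A B : structure L) := LMap {
  lang_part : lang_perm L;
  vert_part : A -> B
}.

Definition lmap_comp (L : language) (A B C : structure L)
    (g : lmap B C) (f : lmap A B) : lmap A C :=
  LMap (lang_comp (lang_part g) (lang_part f)) (vert_part g \o vert_part f).

Definition is_hom (L : language) (Gam : perm_group L) (A B : structure L)
    (f : lmap A B) : Prop :=
  [/\ Gam (lang_part f),
      forall n (R : rel_symb L n) (x : n.-tuple A), rel_of R x ->
        rel_of (on_rel (lang_part f) n R) (map_tuple (vert_part f) x)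
    & forall n (F : fun_symb L n) (x : n.-tuple A),
        vert_part f @` fun_of F x `<=`
        fun_of (on_fun (lang_part f) n F) (map_tuple (vert_part f) x)].

Definition is_embedding (L : language) (Gam : perm_group L)
    (A B : structure L) (f : lmap A B) : Prop :=
  [/\ is_hom Gam f,
      injective (vert_part f),
      forall n (R : rel_symb L n) (x : n.-tuple A), rel_of R x <->
        rel_of (on_rel (lang_part f) n R) (map_tuple (vert_part f) x)
    & forall n (F : fun_symb L n) (x : n.-tuple A),
        vert_part f @` fun_of F x =
        fun_of (on_fun (lang_part f) n F) (map_tuple (vert_part f) x)].

Definition is_isomorphism (L : language) (Gam : perm_group L)
    (A B : structure L) (f : lmap A B) : Prop :=
  is_embedding Gam f /\ bijective (vert_part f).

Definition is_automorphism (L : language) (Gam : perm_group L)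
    (A : structure L) (f : lmap A A) : Prop := is_isomorphism Gam f.

(* A substructure is determined by its vertex set, which has to be closed under
   all functions; see [substructureP] below. *)
Definition fun_closed (L : language) (A : structure L) (X : set A) : Prop :=
  forall n (F : fun_symb L n) (x : n.-tuple A),
    (forall i, X (tnth x i)) -> fun_of F x `<=` X.

Record substructure (L : language) (A : structure L) := Substructure {
  sub_set : set A;
  sub_closed : fun_closed sub_set
}.

Definition sub_interp (L : language) (A : structure L) (X : set A) :
    interpretation L {x : A | x \in X} :=
  Interpretation (fun n (R : rel_symb L n) x => rel_of R (map_tuple val x))
                 (fun n (F : fun_symb L n) x y =>
                    fun_of F (map_tuple val x) (val y)).

Definition sub_structure (L : language) (A : structure L)
    (X : substructure A) : structure L :=
  @Structure L {x : A | x \in sub_set X} (sub_interp (sub_set X)).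

Coercion sub_structure : substructure >-> structure.

Definition sub_incl (L : language) (A : structure L) (X : substructure A) :
    lmap X A :=
  @LMap L X A (lang_id L) val.

Lemma substructureP (L : language) (Gam : perm_group L) (A : structure L)
    (X : set A) (S : interpretation L {x : A | x \in X}) :
  is_embedding Gam
    (@LMap L (@Structure L {x : A | x \in X} S) A (lang_id L) val) <->
  fun_closed X /\ S = sub_interp X.
Proof.
have liftX n (x : n.-tuple A) : (forall i, X (tnth x i)) ->
    exists y : n.-tuple {x : A | x \in X}, x = map_tuple val y.
  move=> Xx; exists [tuple exist (fun x => x \in X) _ (mem_set (Xx i)) | i < n].
  by apply: eq_from_tnth => i; rewrite tnth_map tnth_mktuple.
split=> [[_ _ relE funE]|[Xcl ->]].
  split=> [n F x /liftX[y ->] z|].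
    by rewrite -(funE n F y) => -[t _ <-] /=; exact/set_mem/valP.
  case: S relE funE => SR SF /= relE funE; congr Interpretation.
    apply: functional_extensionality_dep => n; apply/funext => R.
    by apply/funext => x; apply/propext; exact: relE.
  apply: functional_extensionality_dep => n; apply/funext => F.
  apply/funext => x; apply/funext => y; apply/propext.
  move: (funE n F x); rewrite /fun_of /= => <-; split=> [Fy|]; first by exists y.
  by move=> [z Fz /val_inj <-].
split=> [|||n F x] //; last 1 first.
- apply/seteqP; split=> [_ [y Fy <-]//|y Fy].
  have Xy : X y.
    by apply: Xcl Fy => i; rewrite tnth_map; exact/set_mem/valP.
  by exists (exist (fun x => x \in X) y (mem_set Xy)).
- by split=> [|//|n F x _ [y Fy <-]//]; exact: perm_group_id.
Qed.

Definition sub_sub_incl (L : language) (A : structure L)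
    (X Y : substructure A) (XY : sub_set X `<=` sub_set Y) : lmap X Y :=
  @LMap L X Y (lang_id L)
    (fun x : X => exist (fun a : A => a \in sub_set Y) (val x)
                        (mem_set (XY _ (set_mem (valP x))))).

Lemma image_closed (L : language) (Gam : perm_group L) (A B : structure L)
    (f : lmap A B) : is_embedding Gam f -> fun_closed (range (vert_part f)).
Proof.
move=> [_ _ _ funE] n F x xf.
have [y ->] : exists y : n.-tuple A, x = map_tuple (vert_part f) y.
  have /choice[h hE] i : exists a, vert_part f a = tnth x i.
    by have [a _ fa] := xf i; exists a.
  exists (mktuple h); apply: eq_from_tnth => i.
  by rewrite tnth_map tnth_mktuple hE.
rewrite -[F](perm_invK (on_fun (lang_part f) n)) -funE.
by move=> _ [z _ <-]; exists z.
Qed.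

Definition image_structure (L : language) (Gam : perm_group L)
    (A B : structure L) (f : lmap A B) (fP : is_embedding Gam f) :
    substructure B :=
  Substructure (image_closed fP).

Section Amalgamation.

Variables (L : language) (Gam : perm_group L) (A B1 B2 C : structure L).
Variables (a1 : lmap A B1) (a2 : lmap A B2) (b1 : lmap B1 C) (b2 : lmap B2 C).

Definition is_amalgamation : Prop :=
  [/\ is_embedding Gam a1, is_embedding Gam a2,
      is_embedding Gam b1, is_embedding Gam b2
    & lmap_comp b1 a1 = lmap_comp b2 a2].

Definition is_strong_amalgamation : Prop :=
  is_amalgamation /\
  range (vert_part b1) `&` range (vert_part b2) =
  range (vert_part (lmap_comp b1 a1)).

Definition is_mixed (n : nat) (x : n.-tuple C) : Prop :=
  (exists i, (vert_part b1 @` ~` range (vert_part a1)) (tnth x i)) /\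
  (exists i, (vert_part b2 @` ~` range (vert_part a2)) (tnth x i)).

Definition is_free_amalgamation : Prop :=
  [/\ is_strong_amalgamation,
      [set: C] = range (vert_part b1) `|` range (vert_part b2)
    & forall n (x : n.-tuple C), is_mixed x ->
        (forall R : rel_symb L n, ~ rel_of R x) /\
        (forall F : fun_symb L n, fun_of F x = set0)].

End Amalgamation.

Definition irreducible (L : language) (Gam : perm_group L)
    (C : structure L) : Prop :=
  ~ exists (B1 B2 A : substructure C)
      (AB1 : sub_set A `<=` sub_set B1) (AB2 : sub_set A `<=` sub_set B2),
    [/\ sub_set B1 <> [set: C], sub_set B2 <> [set: C]
      & is_free_amalgamation Gam (sub_sub_incl AB1) (sub_sub_incl AB2)
          (sub_incl B1) (sub_incl B2)].

(* A partial automorphism of D is a term [f : lmap X Y], with X and Y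
   substructures of D, such that [is_isomorphism Gam f]; its domain is X and its
   range is Y. In [extends], D is itself a substructure of B, hence the two
   projections from the vertices of X to those of B. *)
Definition extends (L : language) (B : structure L) (D : substructure B)
    (X Y : substructure D) (f : lmap X Y) (t : lmap B B) : Prop :=
  lang_part t = lang_part f /\
  forall x : X, vert_part t (val (val x)) = val (val (vert_part f x)).

Section EPPA.

Variables (L : language) (Gam : perm_group L) (A B : structure L).
Variables (psi : lmap A B) (psiP : is_embedding Gam psi).

Let D := image_structure psiP.

Definition extension_property : Prop :=
  forall (X Y : substructure D) (f : lmap X Y), is_isomorphism Gam f ->
    exists t : lmap B B, is_automorphism Gam t /\ extends f t.

Definition coherent_extension_property : Prop :=
  exists hat : forall X Y : substructure D, lmap X Y -> lmap B B,
    (forall (X Y : substructure D) (f : lmap X Y), is_isomorphism Gam f ->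
       is_automorphism Gam (hat X Y f) /\ extends f (hat X Y f)) /\
    (forall (X Y Z : substructure D) (f : lmap X Y) (g : lmap Y Z),
       is_isomorphism Gam f -> is_isomorphism Gam g ->
       hat X Z (lmap_comp g f) = lmap_comp (hat Y Z g) (hat X Y f)).

Definition irreducible_structure_faithful : Prop :=
  forall C : substructure B, irreducible Gam C ->
    exists g : lmap B B, is_automorphism Gam g /\
      vert_part g @` sub_set C `<=` sub_set D.

End EPPA.

Definition faithful_coherent_EPPA_witness (L : language) (Gam : perm_group L)
    (A B : structure L) : Prop :=
  [/\ finite_structure A, finite_structure B
    & exists (psi : lmap A B) (psiP : is_embedding Gam psi),
        [/\ extension_property psiP, coherent_extension_property psiP
          & irreducible_structure_faithful psiP]].

(* Main.v *)
From HB Require Import structures.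
Require Import Defs.
From mathcomp Require Import all_boot all_fingroup.
From mathcomp Require Import boolp.

Set Implicit Arguments.
Unset Strict Implicit.
Unset Printing Implicit Defensive.

(** The idea of the proof.

    Regard a vertex set X of A together with all ways in which it could be
    interpreted.  The information which interpretation s of X is the right one
    can be spread over X: each vertex of X carries one bit for each s, and s is
    the right one when these bits have odd sum.  Adjoin to the vertices of A
    all possible assignments of bits.  A permutation of A and a relabelling now
    act after correction by an arbitrary change of the bits that preserves all
    sums, and a partial automorphism of A with domain D extends to such a
    permutation: for X inside D the required change preserves the sum because
    the partial automorphism respects interpretations, and for any other X
    there is a vertex outside D whose bit can be used to repair the sum
    ([parity_system]).

    The images of A under the permutations so obtained are called copies of A.
    A set that lies in no copy may still have all its pairs in copies, which
    spoils faithfulness.  Hence a second extension: for each set X that lies in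
    no copy, each point gets a label from a set of |X| - 1 labels, injectively
    on X intersected with a copy.  A set of points with projection X all of
    whose pairs lie in copies would need |X| labels, so there is none
    ([generic_pair_faithful]).

    Unary functions are added last.  An element c of the permutation group is
    seen as a chart, a copy of A with a relabelled structure; a vertex of the
    witness is a vertex x in a chart c, and the same vertex may be seen in two
    charts when these agree around it: they agree, together with all unary
    functions, on a set that contains x and is closed under the functions.
    The relations are those that hold inside some chart.  This does not create
    new relations or function values on A, because a motion that maps some
    vertices of A into A is a local isomorphism there, where a local
    isomorphism is also asked to preserve the number of values of each
    function: on a closed set it is then a genuine isomorphism onto a closed
    set.  All permutations fix the constants; since functions have no values on
    constants, all charts agree around them, and each constant is one vertex of
    the witness.

    In an irreducible substructure any two vertices are seen in a common chart
    ([common_chart]), because the vertices that do not generate u and those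
    that do not generate v are closed sets that would exhibit a free
    amalgamation.  Its projection therefore lies in a copy, which is moved
    onto A; counting function values then shows that the substructure itself
    is moved into A ([amalgam_faithful]).

    Coherence costs nothing: every extension step first extends the data on
    the domain and on the range, each in a way depending only on that set, and
    then takes the difference of the two extensions ([ext_comp], [lift_comp]). *)


(** * Images under permutations *)

Section PermImage.

Variable T : finType.
Implicit Types (s : {perm T}) (X : {set T}).
Local Open Scope group_scope.

Lemma imset_perm1 X : (1 : {perm T}) @: X = X.
Proof. by rewrite -[RHS]imset_id; apply: eq_imset => x; rewrite perm1. Qed.

Lemma imset_permM s s' X : (s * s') @: X = s' @: (s @: X).
Proof. by rewrite -imset_comp; apply: eq_imset => x; rewrite permM. Qed.

Lemma imset_permK s X : s^-1 @: (s @: X) = X.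
Proof. by rewrite -imset_permM mulgV imset_perm1. Qed.

Lemma imset_permKV s X : s @: (s^-1 @: X) = X.
Proof. by rewrite -imset_permM mulVg imset_perm1. Qed.

Lemma mem_imset_perm s X x : (s x \in s @: X) = (x \in X).
Proof. by rewrite mem_imset //; apply: perm_inj. Qed.

End PermImage.

(** * Functorial extension of partial injections *)

Section Extension.

Variable T : finType.
Implicit Types (V : {set T}) (f g : T -> T).

(** The complements of the domain and of the range are matched along their
    enumerations; a matching that factors through an index is compatible with
    composition. *)
Definition ext_fun V f (t : T) : T :=
  if t \in V then f t
  else nth t (enum (~: (f @: V))) (index t (enum (~: V))).

Definition ext V f : {perm T} :=
  odflt 1%g [pick s : {perm T} | [forall t, s t == ext_fun V f t]].

Lemma card_setC_imset V f : {in V &, injective f} -> #|~: (f @: V)| = #|~: V|.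
Proof.
move=> inj; apply/eqP; rewrite -(eqn_add2l #|f @: V|) cardsC.
by rewrite card_in_imset // cardsC.
Qed.

Lemma ext_fun_out V f t : {in V &, injective f} -> t \notin V ->
  [/\ ext_fun V f t \notin f @: V, 
      index (ext_fun V f t) (enum (~: (f @: V))) = index t (enum (~: V))
    & (index t (enum (~: V)) < #|~: (f @: V)|)%N].
Proof.
move=> inj tV; have tE : t \in enum (~: V) by rewrite mem_enum inE.
have lt_i : (index t (enum (~: V)) < #|~: (f @: V)|)%N.
  by rewrite card_setC_imset // cardE index_mem.
rewrite /ext_fun (negbTE tV); split=> //.
  have: nth t (enum (~: (f @: V))) (index t (enum (~: V))) \in enum (~: (f @: V)).
    by apply: mem_nth; rewrite -cardE.
  by rewrite mem_enum inE.
by rewrite index_uniq ?enum_uniq // -cardE.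
Qed.

Lemma ext_fun_inj V f : {in V &, injective f} -> injective (ext_fun V f).
Proof.
move=> inj t u; case tV: (t \in V); case uV: (u \in V).
- by rewrite /ext_fun tV uV; apply: inj.
- have [] := ext_fun_out inj (negbT uV) => + _ _ eq_tu.
  by rewrite -eq_tu /ext_fun tV imset_f.
- have [] := ext_fun_out inj (negbT tV) => + _ _ eq_tu.
  by rewrite eq_tu /ext_fun uV imset_f.
have [_ <- _] := ext_fun_out inj (negbT uV) => eq_tu.
have [_ + _] := ext_fun_out inj (negbT tV); rewrite eq_tu => eq_i.
have [_ + _] := ext_fun_out inj (negbT uV); rewrite eq_i.
by apply: (index_inj t) => //; rewrite mem_enum inE ?tV ?uV.
Qed.

Lemma extE V f : {in V &, injective f} -> ext V f =1 ext_fun V f.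
Proof.
move=> inj; rewrite /ext; case: pickP => [s /forallP sE t|/(_ (perm (ext_fun_inj inj)))].
  exact/eqP.
by move=> /negP[]; apply/forallP => t; rewrite permE.
Qed.

Lemma ext_in V f : {in V &, injective f} -> {in V, ext V f =1 f}.
Proof. by move=> inj t tV; rewrite extE // /ext_fun tV. Qed.

Lemma eq_ext V f g : {in V, f =1 g} -> ext V f = ext V g.
Proof.
move=> fg; rewrite /ext; congr odflt; apply: eq_pick => s.
apply: eq_forallb => t; rewrite /ext_fun (eq_in_imset fg).
by case: ifP => // /fg ->.
Qed.

(** The source of coherence: the index of a point outside the domain is an
    invariant of the extension. *)
Lemma ext_comp V f g : {in V &, injective f} -> {in f @: V &, injective g} ->
  ext V (g \o f) = (ext V f * ext (f @: V) g)%g.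
Proof.
move=> injf injg; apply/permP => t; rewrite permM.
have injgf : {in V &, injective (g \o f)}.
  by move=> x y xV yV /injg /injf; apply=> //; apply: imset_f.
rewrite !extE //; case tV: (t \in V); first by rewrite /ext_fun tV imset_f.
have [u_out idx_u lt_u] := ext_fun_out injf (negbT tV).
move: (ext_fun V f t) u_out idx_u => u u_out idx_u.
rewrite /ext_fun tV (negbTE u_out) idx_u imset_comp.
apply: set_nth_default; rewrite -cardE card_setC_imset //.
Qed.

End Extension.

(** * Extension systems *)

Section Systems.

Variables (T : finType) (gT : finGroupType) (K : {set T}).
Local Open Scope group_scope.

(** [I X e k] is to be read: the restriction of [e] to [X], with the language
    part [k], is an isomorphism onto its image.  The product of permutations
    applies its left factor first. *)
Record local_isos (I : {set T} -> {perm T} -> gT -> bool) := LocalIsos {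
  loc1 : forall X, I X 1 1;
  locM : forall X e k e' k',
    I X e k -> I (e @: X) e' k' -> I X (e * e') (k * k');
  locV : forall X e k, I X e k -> I (e @: X) e^-1 k^-1;
  locS : forall (X Y : {set T}) e k, Y \subset X -> I X e k -> I Y e k;
  eq_loc : forall (X : {set T}) (e e' : {perm T}) k, {in X, e =1 e'} -> I X e k -> I X e' k
}.

Variable I : {set T} -> {perm T} -> gT -> bool.

Definition admissible (D : {set T}) (p : {perm T}) (g : gT) : Prop :=
  [/\ K \subset D, {in K, forall x, p x = x} & I D p g].

(** A finite space containing the base [T], with a group of permutations of the
    space labelled by language parts.  The group fixes the constants [K]; the
    partial automorphisms lift to it functorially; and conversely a group
    element that maps part of the base into the base is a local isomorphism
    there, so the group has no unwanted elements. *)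
Record ext_system := ExtSystem {
  space : finType;
  motions : {group {perm space} * gT};
  emb : T -> space;
  lift : {set T} -> {perm T} -> gT -> {perm space};
  emb_inj : injective emb;
  motions_fix : forall (h : {perm space} * gT) x,
    h \in motions -> x \in K -> h.1 (emb x) = emb x;
  motions_local : forall (h : {perm space} * gT) (X : {set T}) (e : {perm T}),
    h \in motions ->
    {in X, forall x, h.1 (emb x) = emb (e x)} -> I X e h.2;
  lift_in : forall D p g, admissible D p g -> (lift D p g, g) \in motions;
  lift_emb : forall (D : {set T}) p g, admissible D p g ->
    {in D, forall x, lift D p g (emb x) = emb (p x)};
  lift_comp : forall D p g p' g',
    admissible D p g -> admissible (p @: D) p' g' ->
    lift D (p * p') (g * g') = lift D p g * lift (p @: D) p' g'
}.

End Systems.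

(** * Parity *)

Section Parity.

Variables (T : finType) (gT : finGroupType) (K : {set T}).
Variable I : {set T} -> {perm T} -> gT -> bool.
Hypothesis locI : local_isos I.
Local Open Scope group_scope.

(** A context [(X, e, k)] stands for the interpretation of [X] obtained from the
    base by pulling back along [e] and undoing the relabelling [k]; it is active
    when this is how [X] is interpreted in the base.  Distinct triples may stand
    for the same interpretation.  The empty set has no vertex to carry a bit and
    is excluded from the active contexts. *)
Definition context : Type := {set T} * {perm T} * gT.
HB.instance Definition _ := Finite.on context.
Implicit Types (s : context) (D X : {set T}) (p q : {perm T}) (g : gT).

Definition support s : {set T} := s.1.1.
Definition active s : bool := (support s != set0) && I s.1.1 s.1.2 s.2.
Definition context_act p g s : context := (p @: s.1.1, p^-1 * s.1.2, g^-1 * s.2).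

Lemma context_act1 s : context_act 1 1 s = s.
Proof.
case: s => [[X e] k]; rewrite /context_act /= !invg1 !mul1g; congr (_, _, _).
by rewrite imset_perm1.
Qed.

Lemma context_actM p g p' g' s :
  context_act (p * p') (g * g') s = context_act p' g' (context_act p g s).
Proof.
case: s => [[X e] k]; rewrite /context_act /= !invMg !mulgA; congr (_, _, _).
by rewrite imset_permM.
Qed.

Lemma context_actK p g : cancel (context_act p g) (context_act p^-1 g^-1).
Proof. by move=> s; rewrite -context_actM !mulgV context_act1. Qed.

Lemma context_actKV p g : cancel (context_act p^-1 g^-1) (context_act p g).
Proof. by move=> s; rewrite -context_actM !mulVg context_act1. Qed.

Definition parity_space : Type := T * {ffun context -> bool}.
HB.instance Definition _ := Finite.on parity_space.

Definition parity (X : {set T}) (f : T -> bool) : bool :=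
  \big[addb/false]_(x in X) f x.

(** The single nonzero bit of an active context sits at an arbitrary vertex of
    its support. *)
Definition base_val (x : T) s : bool := active s && ([pick y in support s] == Some x).

Definition parity_emb (x : T) : parity_space := (x, [ffun s => base_val x s]).

Definition flips_by (h : {perm parity_space}) p g (phi : T -> context -> bool) : Prop :=
  forall b s, (h b).1 = p b.1 /\
              (h b).2 (context_act p g s) = b.2 s (+) phi b.1 s.

Definition even_flip (phi : T -> context -> bool) : Prop :=
  forall s, parity (support s) (phi^~ s) = false.

(** The condition on [I set0] records that the label is realised by the language
    part of some isomorphism; contexts with empty support cannot express it. *)
Definition parity_set : {set {perm parity_space} * gT} :=
  [set h | `[< I set0 1 h.2 /\
               (exists p phi, even_flip phi /\ flips_by h.1 p h.2 phi) /\
               {in K, forall x, h.1 (parity_emb x) = parity_emb x} >]].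

Lemma flips_by_inj h h' p g phi : flips_by h p g phi -> flips_by h' p g phi -> h = h'.
Proof.
move=> hP h'P; apply/permP => b; have [h1 _] := hP b (set0, 1, 1).
have [h'1 _] := h'P b (set0, 1, 1).
rewrite [LHS]surjective_pairing [RHS]surjective_pairing h1 h'1; congr (_, _).
apply/ffunP => s; rewrite -[s](context_actKV p g).
have [_ ->] := hP b (context_act p^-1 g^-1 s).
by have [_ ->] := h'P b (context_act p^-1 g^-1 s).
Qed.

Lemma flips_by_comp h h' p p' g g' phi phi' :
  flips_by h p g phi -> flips_by h' p' g' phi' ->
  flips_by (h * h') (p * p') (g * g')
          (fun x s => phi x s (+) phi' (p x) (context_act p g s)).
Proof.
move=> hP h'P b s; have [h1 h2] := hP b s.
have [h'1 h'2] := h'P (h b) (context_act p g s).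
by rewrite !permM h'1 h1 context_actM h'2 h2 h1 addbA.
Qed.

Lemma parity_imset p X f : parity (p @: X) f = parity X (f \o p).
Proof. by rewrite /parity big_imset //= => x y _ _; apply: perm_inj. Qed.

Lemma parityD X f f' :
  parity X (fun x => f x (+) f' x) = parity X f (+) parity X f'.
Proof. by rewrite /parity big_split. Qed.

Lemma eq_parity X f f' : {in X, f =1 f'} -> parity X f = parity X f'.
Proof. by move=> ff'; apply: eq_bigr. Qed.

Lemma exists_flips_by p g phi : exists h, flips_by h p g phi.
Proof.
pose F (b : parity_space) : parity_space := (p b.1, [ffun s =>
  b.2 (context_act p^-1 g^-1 s) (+) phi b.1 (context_act p^-1 g^-1 s)]).
have F_inj : injective F.
  move=> [x u] [y v] [/perm_inj eq_xy /ffunP uv]; congr (_, _) => //.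
  apply/ffunP => s; have := uv (context_act p g s); rewrite !ffunE /= context_actK eq_xy.
  by move=> /addIb.
exists (perm F_inj) => b s; rewrite permE; split=> //=.
by rewrite ffunE context_actK.
Qed.

Lemma parity_group_set : group_set parity_set.
Proof.
apply/group_setP; split.
  rewrite inE; apply/asboolP; split; first exact: (loc1 locI).
  split; last by move=> x _; rewrite perm1.
  exists 1, (fun _ _ => false); split=> [s|b s]; first by apply: big1.
  by rewrite context_act1 !perm1 addbF.
move=> h h'; rewrite !inE => /asboolP[I0 [[p [phi [ev hP]]] hK]].
move=> /asboolP[I0' [[p' [phi' [ev' h'P]]] h'K]]; apply/asboolP; split.
  by rewrite -[1](mulg1 1); apply: (locM locI); rewrite ?imset0.
split; last by move=> x xK; rewrite permM hK ?h'K.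
exists (p * p'), (fun x s => phi x s (+) phi' (p x) (context_act p h.2 s)).
split; last exact: flips_by_comp.
move=> s; rewrite parityD ev addFb.
by have := ev' (context_act p h.2 s); rewrite parity_imset.
Qed.

Canonical parity_group := Group parity_group_set.

Lemma parity_emb_inj : injective parity_emb.
Proof. by move=> x y []. Qed.

Lemma parity_base_val s : parity (support s) (base_val^~ s) = active s.
Proof.
rewrite /parity /base_val; case: pickP => [x xs|s0].
  rewrite (bigD1 x) //= eqxx andbT big1 ?addbF // => y /andP[_ yx].
  by apply/negP => /andP[_ /eqP[xy]]; rewrite xy eqxx in yx.
rewrite big1 => [|x]; last by rewrite [x \in _]s0.
apply/esym/negbTE; rewrite negb_and negbK; apply/orP; left.
by apply/eqP/setP => x; rewrite inE; apply: s0.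
Qed.

(** An assignment of bits that agrees with the base on [D] and has even sum on
    each context reaching outside [D]; it depends on [D] only. *)
Definition val_ext D (x : T) s : bool :=
  if (support s \subset D) || (x \in D) then base_val x s
  else ([pick y in support s :\: D] == Some x) &&
       parity (support s :&: D) (base_val^~ s).

Lemma parity_val_ext D s :
  parity (support s) (val_ext D^~ s) = (support s \subset D) && active s.
Proof.
rewrite /val_ext; case: (boolP (support s \subset D)) => sD /=.
  exact: parity_base_val.
set P := parity (support s :&: D) _.
rewrite /parity (bigID (mem D)) /=.
have -> : \big[addb/false]_(x in support s | x \in D)
            (if x \in D then base_val x s else
             ([pick y in support s :\: D] == Some x) && P) = P.
  by rewrite /P /parity; apply: eq_big => x; [rewrite inE | case/andP=> _ ->].
case: pickP => [x /= xs|s0]; last first.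
  case/negP: sD; apply/fintype.subsetP => x xs.
  by have /= := s0 x; rewrite !inE xs andbT => /negbFE.
have := xs; rewrite !inE => /andP[xD xS].
rewrite (bigD1 x) ?xS ?xD //= (negbTE xD) eqxx /= big1 ?addbF ?addbb // => y.
by move=> /andP[/andP[_ /negbTE->] /negbTE yx]; rewrite (inj_eq Some_inj) eq_sym yx.
Qed.

(** A difference of two assignments of bits, one for the domain and one for the
    range; such differences add up along compositions. *)
Definition lift_flip D p g x s : bool :=
  val_ext D x s (+) val_ext (p @: D) (p x) (context_act p g s).

Definition parity_lift D p g : {perm parity_space} :=
  projT1 (cid (exists_flips_by p g (lift_flip D p g))).

Lemma parity_liftP D p g : flips_by (parity_lift D p g) p g (lift_flip D p g).
Proof. exact: (projT2 (cid (exists_flips_by p g (lift_flip D p g)))). Qed.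

Lemma active_act D p g s : I D p g -> support s \subset D ->
  active (context_act p g s) = active s.
Proof.
case: s => [[X e] k] ID XD; rewrite /active /support /= in XD *.
rewrite imset_eq0; congr (_ && _); have IX := locS locI XD ID.
have /= IV := locV locI IX; apply/idP/idP => [|Ie].
  by move=> /(locM locI IX); rewrite !mulKVg.
by apply: (locM locI IV); rewrite imset_permK.
Qed.

(** On contexts inside [D] the two sums agree because isomorphisms preserve
    activity; on the other contexts both sums are even by construction. *)
Lemma lift_flip_even D p g : I D p g -> even_flip (lift_flip D p g).
Proof.
move=> ID s; rewrite /lift_flip parityD parity_val_ext.
have := parity_val_ext (p @: D) (context_act p g s); rewrite parity_imset => ->.
have -> : (p @: support s \subset p @: D) = (support s \subset D).
  apply/idP/idP => [|/imsetS//] /(imsetS p^-1).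
  by rewrite !imset_permK.
case: (boolP (_ \subset _)) => //= sD.
by rewrite (active_act ID) // addbb.
Qed.

Lemma parity_lift_emb D p g :
  {in D, forall x, parity_lift D p g (parity_emb x) = parity_emb (p x)}.
Proof.
move=> x xD; have hP := parity_liftP D p g (parity_emb x).
rewrite [LHS]surjective_pairing (proj1 (hP (set0, 1, 1))); congr (_, _).
apply/ffunP => s; rewrite -[s](context_actKV p g) (proj2 (hP _)) !ffunE.
by rewrite /lift_flip /val_ext xD imset_f ?orbT // addKb.
Qed.

Lemma parity_lift_in D p g : admissible K I D p g ->
  (parity_lift D p g, g) \in parity_group.
Proof.
case=> KD pK ID; rewrite inE; apply/asboolP; split.
  by apply: (eq_loc locI _ (locS locI (sub0set D) ID)) => x; rewrite inE.
split; last by move=> x xK; rewrite parity_lift_emb ?pK // (fintype.subsetP KD).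
by exists p, (lift_flip D p g); split; [exact: lift_flip_even | exact: parity_liftP].
Qed.

Lemma parity_lift_comp D p g p' g' :
  parity_lift D (p * p') (g * g') = parity_lift D p g * parity_lift (p @: D) p' g'.
Proof.
apply: flips_by_inj (parity_liftP _ _ _) _.
move=> b s; have := flips_by_comp (parity_liftP D p g) (parity_liftP (p @: D) p' g') b s.
case=> -> ->; split=> //; congr (_ (+) _); rewrite /lift_flip.
by rewrite addbA addbK context_actM permM imset_permM.
Qed.

(** A context which says that [X] is interpreted by itself is active.  Even flips
    preserve the sum of its bits, hence its image is active as well, and this
    says that the motion is a local isomorphism on [X]. *)
Lemma parity_group_local (h : {perm parity_space} * gT) X (e : {perm T}) :
  h \in parity_group ->
  {in X, forall x, h.1 (parity_emb x) = parity_emb (e x)} -> I X e h.2.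
Proof.
rewrite inE => /asboolP[I0 [[p [phi [ev hP]]] _]] he.
have [X0|X_neq0] := eqVneq X set0.
  by rewrite X0; apply: (eq_loc locI _ I0) => x; rewrite inE.
have pe : {in X, p =1 e}.
  by move=> x xX; have [<- _] := hP (parity_emb x) (set0, 1, 1); rewrite he.
apply: (eq_loc locI pe); pose s : context := (X, 1, 1).
  (* The bits of the image context, summed along p, are the bits of s plus an
     even flip. *)
have act_s : active (context_act p h.2 s).
  rewrite -parity_base_val parity_imset /=.
  rewrite (@eq_parity _ _ (fun x => base_val x s (+) phi x s)); last first.
    move=> x xX /=; have [_] := hP (parity_emb x) s.
    by rewrite he // !ffunE /= pe.
  by rewrite parityD -[X]/(support s) ev parity_base_val addbF /active X_neq0 (loc1 locI).
case/andP: act_s => _ /=; rewrite !mulg1 => /(locV locI); rewrite !invgK.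
by rewrite imset_permK.
Qed.

Definition parity_system : ext_system K I.
Proof.
apply: (@ExtSystem _ _ _ _ parity_space parity_group parity_emb parity_lift parity_emb_inj).
- by move=> h x; rewrite inE => /asboolP[_ [_ hK]] /hK.
- exact: parity_group_local.
- exact: parity_lift_in.
- by move=> D p g _; apply: parity_lift_emb.
- by move=> D p g p' g' _ _; apply: parity_lift_comp.
Defined.

End Parity.

(** * Genericity *)

Section Generic.

Variables (T : finType) (gT : finGroupType) (K : {set T}).
Variable I : {set T} -> {perm T} -> gT -> bool.
Local Open Scope group_scope.

Definition in_copy (E : ext_system K I) (X : {set space E}) : Prop :=
  exists2 h, h \in motions E & X \subset h.1 @: (emb E @: T).

(** The set-theoretic core of faithfulness.  The base points of [K] lie in every
    copy; having them in [Z] forces the motion onto the copy found in the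
    conclusion to fix them, as all motions do. *)
Definition pair_faithful (E : ext_system K I) : Prop :=
  forall Z : {set space E}, emb E @: K \subset Z ->
  (forall u v, u \in Z -> v \in Z -> in_copy [set u; v]) -> in_copy Z.

Variable E : ext_system K I.
Notation B := (space E).
Notation copy := (emb E @: T).
Implicit Types (X : {set B}) (h : {perm B}) (g : gT) (theta : {set B} -> {perm B}).

Definition bad X : bool := `[< ~ in_copy X >].

(** The labels for a bad set [X] are the points of [X] other than one point
    outside the base.  There are |X| - 1 of them, and each base point of [X] can
    be its own label. *)
Definition spare X : option B := [pick b in X :\: copy].

Definition generic_space : Type := B * {ffun {set B} -> B}.
HB.instance Definition _ := Finite.on generic_space.

(** Every base point takes itself as its label, for all sets at once. *)
Definition generic_emb (x : T) : generic_space := (emb E x, [ffun=> emb E x]).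

(** A permutation subject to these conditions maps the labels for [X] onto the
    labels for the image of [X]; prescribing it outside [X] and at the spare
    point is easier to compose than that property. *)
Definition twist h theta : Prop := forall X, bad X ->
  {in ~: X, theta X =1 h} /\ omap (theta X) (spare X) = spare (h @: X).

Definition relabels_by (s : {perm generic_space}) h theta : Prop := forall b X,
  (s b).1 = h b.1 /\
  (s b).2 (h @: X) = if (b.1 \in X) && bad X then theta X (b.2 X) else h (b.2 X).

Definition generic_set : {set {perm generic_space} * gT} :=
  [set s : {perm generic_space} * gT | `[<
     {in K, forall x, s.1 (generic_emb x) = generic_emb x} /\
     exists h theta, [/\ (h, s.2) \in motions E, twist h theta
                         & relabels_by s.1 h theta] >]].

Lemma bad_act h g X : (h, g) \in motions E -> bad (h @: X) = bad X.
Proof.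
move=> hG; rewrite /bad !asbool_neg; congr (~~ _); apply: asbool_equiv_eq; split.
  case=> -[h' g'] h'G /= Xh'; exists (h' * h^-1, g' * g^-1).
    by have := groupM h'G (groupVr hG).
  apply/fintype.subsetP => x xX /=.
  have /(fintype.subsetP Xh')/imsetP[y yc hxy] : h x \in h @: X by apply: imset_f.
  by apply/imsetP; exists y; rewrite // permM -hxy permK.
case=> -[h' g'] h'G /= Xh'; exists (h' * h, g' * g); first exact: (groupM h'G hG).
apply/fintype.subsetP => _ /imsetP[x /(fintype.subsetP Xh')/imsetP[y yc ->] ->] /=.
by apply/imsetP; exists y; rewrite // permM.
Qed.

Lemma bad_spare X : bad X -> exists b, [/\ spare X = Some b, b \in X & b \notin copy].
Proof.
rewrite /spare => /asboolP Xbad; case: pickP => [b|X0]; last first.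
  case: Xbad; exists 1; first exact: group1.
  apply/fintype.subsetP => x xX; apply/imsetP; exists x; last by rewrite perm1.
  by have /= := X0 x; rewrite !inE xX andbT => /negbFE.
by rewrite inE => /andP[bc bX]; exists b.
Qed.

Lemma relabels_by_inj s s' h theta :
  relabels_by s h theta -> relabels_by s' h theta -> s = s'.
Proof.
move=> sP s'P; apply/permP => b; have [s1 _] := sP b set0; have [s'1 _] := s'P b set0.
rewrite [LHS]surjective_pairing [RHS]surjective_pairing s1 s'1; congr (_, _).
apply/ffunP => Y; rewrite -(imset_permKV h Y).
by have [_ ->] := sP b (h^-1 @: Y); have [_ ->] := s'P b (h^-1 @: Y).
Qed.

Lemma relabels_by_comp s s' h h' theta theta' g : (h, g) \in motions E ->
  relabels_by s h theta -> relabels_by s' h' theta' ->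
  relabels_by (s * s') (h * h') (fun X => theta X * theta' (h @: X)).
Proof.
move=> hG sP s'P b X; have [s1 s2] := sP b X.
have [s'1 s'2] := s'P (s b) (h @: X).
rewrite ?imset_permM.
rewrite !permM s'1 s1 s'2 s1 s2 (bad_act _ hG) mem_imset_perm.
by split=> //; case: (_ && _).
Qed.

Lemma twist_comp h h' theta theta' g : (h, g) \in motions E ->
  twist h theta -> twist h' theta' ->
  twist (h * h') (fun X => theta X * theta' (h @: X)).
Proof.
move=> hG tP t'P X Xbad; have [t1 t2] := tP X Xbad.
have [|t'1 t'2] := t'P (h @: X); first by rewrite (bad_act _ hG).
split=> [x xX|].
  rewrite !permM t1 // t'1 // inE mem_imset_perm.
  by rewrite -in_setC.
rewrite ?imset_permM.
by rewrite -t'2 -t2; case: spare => //= x; rewrite permM.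
Qed.

Lemma exists_relabels_by h theta : exists s, relabels_by s h theta.
Proof.
pose F (b : generic_space) : generic_space := (h b.1, [ffun Y : {set B} =>
  let X := h^-1 @: Y in
  if (b.1 \in X) && bad X then theta X (b.2 X) else h (b.2 X)]).
have F_inj : injective F.
  move=> [x u] [y v] [/perm_inj eq_xy /ffunP uv]; congr (_, _) => //.
  apply/ffunP => X; have := uv (h @: X); rewrite !ffunE /= imset_permK eq_xy.
  by case: ifP => _ /perm_inj.
by exists (perm F_inj) => b X; rewrite permE; split=> //=; rewrite ffunE /= imset_permK.
Qed.

Lemma generic_group_set : group_set generic_set.
Proof.
apply/group_setP; split.
  rewrite inE; apply/asboolP; split; first by move=> x _; rewrite perm1.
  exists 1, (fun=> 1); split; first exact: group1.
    move=> X _; rewrite imset_perm1; split=> //.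
    by case: spare => //= x; rewrite perm1.
  move=> b X; rewrite imset_perm1.
  by rewrite !perm1 if_same.
move=> s s'; rewrite !inE => /asboolP[sK [h [theta [hG tP sP]]]].
move=> /asboolP[s'K [h' [theta' [h'G t'P s'P]]]]; apply/asboolP; split.
  by move=> x xK; rewrite permM sK ?s'K.
exists (h * h'), (fun X => theta X * theta' (h @: X)); split.
- exact: (groupM hG h'G).
- exact: twist_comp hG _ _.
- exact: relabels_by_comp hG _ _.
Qed.

Canonical generic_group := Group generic_group_set.

Lemma generic_emb_inj : injective generic_emb.
Proof. by move=> x y [/emb_inj]. Qed.

Definition spare_dom (D : {set T}) X : {set B} :=
  emb E @: D :|: ~: X :|: [set b | spare X == Some b].

(** The forced part of the relabelling for [X]: labels of base points follow the
    motion [h], while spare points correspond to each other even when [h] does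
    not match them. *)
Definition spare_fun h X (b : B) : B :=
  if spare X == Some b then odflt b (spare (h @: X)) else h b.

Definition spare_twist D h X : {perm B} := ext (spare_dom D X) (spare_fun h X).

Definition generic_lift D p g : {perm generic_space} :=
  projT1 (cid (exists_relabels_by (lift E D p g) (spare_twist D (lift E D p g)))).

Lemma generic_liftP D p g :
  relabels_by (generic_lift D p g) (lift E D p g) (spare_twist D (lift E D p g)).
Proof.
exact: (projT2 (cid (exists_relabels_by (lift E D p g) (spare_twist D (lift E D p g))))).
Qed.

Lemma lift_copy D p g : admissible K I D p g ->
  lift E D p g @: (emb E @: D) = emb E @: (p @: D).
Proof.
move=> adm; rewrite -!imset_comp; apply: eq_in_imset => x xD /=.
exact: lift_emb.
Qed.

Lemma spare_fun_inj D p g X : admissible K I D p g -> bad X ->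
  {in spare_dom D X &, injective (spare_fun (lift E D p g) X)}.
Proof.
move=> adm Xbad; have hG := lift_in E adm; set h := lift E D p g in hG *.
have [b [Xb bX bc]] := bad_spare Xbad.
have [|b' [Xb' bX' bc']] := @bad_spare (h @: X); first by rewrite (bad_act _ hG).
have other x : x \in spare_dom D X -> x != b -> h x != b'.
  rewrite !inE Xb (inj_eq Some_inj) => + xb.
  rewrite eq_sym (negbTE xb) orbF => /orP[/imsetP[y yD ->]|xX].
    apply: contraNneq bc' => <-; rewrite /h (lift_emb E adm) //.
    exact: imset_f.
  by apply: contraNneq xX => hx; move: bX'; rewrite -hx mem_imset_perm.
move=> x y xE yE; rewrite /spare_fun Xb Xb' !(inj_eq Some_inj) /=.
case: eqVneq => [<-|xb]; case: eqVneq => [<-|yb] //.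
- by move=> /esym/eqP; rewrite (negbTE (other _ yE _)) // eq_sym.
- by move=> /eqP; rewrite (negbTE (other _ xE _)) // eq_sym.
- exact: perm_inj.
Qed.

Lemma spare_twistP D p g : admissible K I D p g ->
  twist (lift E D p g) (spare_twist D (lift E D p g)).
Proof.
move=> adm X Xbad; have inj := spare_fun_inj adm Xbad.
have hG := lift_in E adm.
have [b [Xb bX bc]] := bad_spare Xbad.
have [|b' [Xb' bX' bc']] := @bad_spare (lift E D p g @: X).
  by rewrite (bad_act _ hG).
split=> [x|]; last first.
  rewrite Xb Xb' /=; congr Some; rewrite ext_in // /spare_fun ?Xb ?eqxx ?Xb' //.
  by rewrite !inE Xb eqxx orbT.
rewrite inE => xX; rewrite ext_in // /spare_fun; last by rewrite !inE xX orbT.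
by rewrite Xb (inj_eq Some_inj); case: eqVneq xX => // <-; rewrite bX.
Qed.

Lemma generic_lift_emb D p g : admissible K I D p g ->
  {in D, forall x, generic_lift D p g (generic_emb x) = generic_emb (p x)}.
Proof.
move=> adm x xD; have sP := generic_liftP D p g (generic_emb x).
have hx := lift_emb E adm xD.
rewrite [LHS]surjective_pairing (proj1 (sP set0)) /= hx; congr (_, _).
apply/ffunP => Y; set h := lift E D p g in sP hx *.
rewrite -(imset_permKV h Y).
have [_ ->] := sP (h^-1 @: Y); rewrite !ffunE /=; case: ifP => // /andP[xX Xbad].
rewrite ext_in /spare_fun //; first last.
- by rewrite !inE imset_f.
- exact: spare_fun_inj.
have [b [Xb bX bc]] := bad_spare Xbad; rewrite Xb (inj_eq Some_inj).
by case: eqVneq => // bx; case/negP: bc; rewrite bx imset_f.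
Qed.

Lemma generic_lift_in D p g : admissible K I D p g ->
  (generic_lift D p g, g) \in generic_group.
Proof.
move=> adm; have [KD pK _] := adm; rewrite inE; apply/asboolP; split.
  by move=> x xK; rewrite generic_lift_emb ?pK // (fintype.subsetP KD).
exists (lift E D p g), (spare_twist D (lift E D p g)).
split; [exact: lift_in | exact: spare_twistP | exact: generic_liftP].
Qed.

Lemma generic_lift_comp D p g p' g' :
  admissible K I D p g -> admissible K I (p @: D) p' g' ->
  generic_lift D (p * p') (g * g') = generic_lift D p g * generic_lift (p @: D) p' g'.
Proof.
move=> adm adm'; apply: relabels_by_inj (generic_liftP _ _ _) _.
have hG := lift_in E adm; have h'G := lift_in E adm'.
move=> b X.
have := relabels_by_comp hG (generic_liftP D p g) (generic_liftP (p @: D) p' g') b X.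
rewrite lift_comp // => -[-> ->]; split=> //; case: ifP => // /andP[_ Xbad].
congr ((_ : {perm B}) _); rewrite /spare_twist.
have h_copy := lift_copy adm; have injf := spare_fun_inj adm Xbad.
set h := lift E D p g in hG h_copy injf *.
set h' := lift E (p @: D) p' g' in h'G *.
have [c [Xc cX cc]] := bad_spare Xbad.
have hXbad : bad (h @: X) by rewrite (bad_act _ hG).
have [c' [Xc' cX' cc']] := bad_spare hXbad.
have [|c'' [Xc'' cX'' cc'']] := @bad_spare (h' @: (h @: X)).
  by rewrite (bad_act _ h'G).
have dom_im : spare_fun h X @: spare_dom D X = spare_dom (p @: D) (h @: X).
  have out x : x \notin X -> spare_fun h X x = h x.
    move=> xX; rewrite /spare_fun Xc (inj_eq Some_inj).
    by case: eqVneq xX => // <-; rewrite cX.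
  have inD x : x \in emb E @: D -> spare_fun h X x = h x.
    move=> /imsetP[y yD ->]; rewrite /spare_fun Xc (inj_eq Some_inj).
    by case: eqVneq => // cy; case/negP: cc; rewrite cy imset_f.
  rewrite !imsetU; congr (_ :|: _ :|: _).
  - by rewrite -h_copy; apply: eq_in_imset.
  - rewrite (eq_in_imset (g := h)) => [|x]; last by rewrite inE => /out.
    by apply/setP => x; rewrite -[x](permKV h) inE !mem_imset_perm inE.
  - rewrite Xc Xc'; have eq1 d : [set b | Some d == Some b] = [set d :> B].
      by apply/setP => x; rewrite !inE (inj_eq Some_inj) eq_sym.
    by rewrite !eq1 imset_set1 /spare_fun Xc eqxx Xc'.
have injg : {in spare_fun h X @: spare_dom D X &,
    injective (spare_fun h' (h @: X))}.
  by rewrite dom_im; apply: spare_fun_inj.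
rewrite -dom_im -ext_comp //; apply: eq_ext => x xE /=.
rewrite {2 3}/spare_fun Xc !(inj_eq Some_inj) Xc' /=.
rewrite ?imset_permM.
case: eqVneq => [<-|cx] /=; first by rewrite Xc'' /spare_fun Xc' eqxx Xc''.
rewrite /spare_fun Xc' (inj_eq Some_inj) permM; case: eqVneq => // hx.
have := injf c x; rewrite /spare_fun Xc Xc' eqxx (inj_eq Some_inj) (negbTE cx) /=.
by move=> /(_ _ xE hx) cx'; rewrite cx' ?eqxx // in cx; rewrite !inE Xc eqxx orbT.
Qed.

Lemma generic_group_local (s : {perm generic_space} * gT) (X : {set T}) (e : {perm T}) :
  s \in generic_group ->
  {in X, forall x, s.1 (generic_emb x) = generic_emb (e x)} -> I X e s.2.
Proof.
rewrite inE => /asboolP[_ [h [theta [hG _ sP]]]] se.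
apply: (motions_local hG) => x xX /=; have [<- _] := sP (generic_emb x) set0.
by rewrite se.
Qed.

Definition generic_system : ext_system K I.
Proof.
apply: (@ExtSystem _ _ _ _ generic_space generic_group generic_emb generic_lift generic_emb_inj).
- by move=> s x; rewrite inE => /asboolP[sK _] /sK.
- exact: generic_group_local.
- exact: generic_lift_in.
- exact: generic_lift_emb.
- exact: generic_lift_comp.
Defined.

(** In every copy the label of a point of a bad set [X] is one of the |X| - 1
    labels for [X]. *)
Lemma relabels_by_emb_bad s h theta g x X : relabels_by s h theta -> (h, g) \in motions E ->
  twist h theta -> bad X -> (s (generic_emb x)).1 \in X ->
  (s (generic_emb x)).2 X \in X /\ spare X != Some ((s (generic_emb x)).2 X).
Proof.
move=> sP hG tP Xbad; have [s1 s2] := sP (generic_emb x) (h^-1 @: X).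
have hK := imset_permKV h X.
have X'bad : bad (h^-1 @: X) by rewrite -(bad_act _ hG) hK.
rewrite s1 hK in s2 *; rewrite s2 X'bad andbT /=.
have -> : (emb E x \in h^-1 @: X) = (h (emb E x) \in X).
  by rewrite -{2}hK mem_imset_perm.
move=> hxX; rewrite hxX ffunE.
have [t1 t2] := tP _ X'bad; rewrite hK in t2.
have [b [Xb bX bc]] := bad_spare X'bad; rewrite Xb /= in t2; rewrite -t2; split.
  apply: contraT => tX; pose y := h^-1 (theta (h^-1 @: X) (emb E x)).
  have yX : y \in ~: (h^-1 @: X).
    by rewrite inE mem_imset_perm.
  have := t1 y yX; rewrite permKV => /perm_inj eq_y.
  by move: yX; rewrite eq_y inE -(mem_imset_perm h) hK hxX.
apply/eqP => -[/perm_inj bx]; case/negP: bc; rewrite bx; exact: imset_f.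
Qed.

(** Two points in a common copy have different labels for every bad set that
    contains their projections.  By the pigeonhole principle the projection of
    [Z] is not bad, so it lies in a copy downstairs; the labels found in [Z] are
    then an admissible choice of the relabelling that lifts this copy. *)
Lemma generic_pair_faithful : pair_faithful generic_system.
Proof.
move=> Z KZ pairZ; pose X : {set B} := [set z.1 | z in Z].
have pairE u v : u \in Z -> v \in Z -> exists s h theta g x y,
    [/\ (h, g) \in motions E, twist h theta, relabels_by s h theta,
        u = s (generic_emb x) & v = s (generic_emb y)].
  move=> uZ vZ; have [[s g]] := pairZ u v uZ vZ.
  rewrite inE => /asboolP[_ [h [theta [hG tP sP]]]] /= /fintype.subsetP sub.
  have /imsetP[_ /imsetP[x _ ->] ->] := sub u (set21 u v).
  have /imsetP[_ /imsetP[y _ ->] ->] := sub v (set22 u v).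
  by exists s, h, theta, g, x, y.
have fstX z : z \in Z -> z.1 \in X by move=> zZ; apply/imsetP; exists z.
have fst_inj : {in Z &, injective fst}.
  move=> u v uZ vZ; have [s [h [theta [g [x [y [_ _ sP -> ->]]]]]]] := pairE u v uZ vZ.
  have [-> _] := sP (generic_emb x) set0; have [-> _] := sP (generic_emb y) set0.
  by move=> /perm_inj /emb_inj ->.
have val_inj Y : bad Y ->
    {in [set z in Z | z.1 \in Y] &, injective (fun z : generic_space => z.2 Y)}.
  move=> Ybad u v; rewrite !inE => /andP[uZ uY] /andP[vZ vY].
  have [s [h [theta [g [x [y [hG tP sP eu ev]]]]]]] := pairE u v uZ vZ.
  move: uY vY; rewrite {}eu {}ev.
  have [+ +] := sP (generic_emb x) (h^-1 @: Y).
  have [+ +] := sP (generic_emb y) (h^-1 @: Y).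
  rewrite imset_permKV => -> -> -> ->.
  rewrite -(bad_act _ hG) imset_permKV Ybad !andbT /=.
  rewrite -!(mem_imset_perm h (h^-1 @: Y)) imset_permKV => -> ->.
  by rewrite !ffunE => /perm_inj /emb_inj ->.
have val_in Y z : bad Y -> z \in Z -> z.1 \in Y ->
    z.2 Y \in Y /\ spare Y != Some (z.2 Y).
  move=> Ybad zZ; have [s [h [theta [g [x [_ [hG tP sP -> _]]]]]]] := pairE z z zZ zZ.
  exact: relabels_by_emb_bad hG tP Ybad.
have val_out (Y : {set B}) (z : generic_space) : z \in Z ->
    ~~ ((z.1 \in Y) && bad Y) -> z.2 Y = z.1.
  move=> zZ; have [s [h [theta [g [x [_ [hG tP sP -> _]]]]]]] := pairE z z zZ zZ.
  have [+ +] := sP (generic_emb x) (h^-1 @: Y); rewrite imset_permKV => -> ->.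
  rewrite -{1 2}(imset_permKV h Y) mem_imset_perm (bad_act _ hG) => /negbTE -> /=.
  by rewrite ffunE.
have Xgood : in_copy X.
  apply: contrapT => /asboolP Xbad; have [b [Xb bX _]] := bad_spare Xbad.
  have: #|X| < #|X|; last by rewrite ltnn.
  have cardX : #|X| = #|Z| by rewrite /X card_in_imset.
  rewrite {1}cardX.
  (* The labels for X are pairwise distinct on Z and all lie in X minus its spare
     point. *)
  have ZX : [set z in Z | z.1 \in X] = Z.
    by apply/setP => z; rewrite inE andb_idr //; apply: fstX.
  have := val_inj X Xbad; rewrite ZX => /card_in_imset cardZ; rewrite -{}cardZ.
  apply: proper_card; apply/properP; split.
    apply/fintype.subsetP => _ /imsetP[z zZ ->].
    by have [] := val_in X z Xbad zZ (fstX z zZ).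
  exists b => //; apply/imsetP => -[z zZ eq_b].
  have [_] := val_in X z Xbad zZ (fstX z zZ).
  by rewrite Xb -eq_b eqxx.
have [[h g] hG /fintype.subsetP /= Xh] := Xgood.
have zeta_ex x : exists z, h (emb E x) \in X -> z \in Z /\ z.1 = h (emb E x).
  have [/imsetP[z zZ ->]|//] := boolP (h (emb E x) \in X); first by exists z.
  by exists (generic_emb x).
have /choice[zeta zetaP] := zeta_ex.
pose base (b : B) : option T := [pick x | emb E x == b].
pose dom (Y : {set B}) : {set B} :=
  [set b | (b \in Y) && (b \in copy) && (h b \in X)] :|: ~: Y
                :|: [set b | spare Y == Some b].
(* The relabelling for Y has to send a base point x of Y to the label that the
   point of Z above h x carries for h Y. *)
pose f (Y : {set B}) (b : B) : B :=
  if spare Y == Some b then odflt b (spare (h @: Y)) else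
  if b \in Y then (if base b is Some x then (zeta x).2 (h @: Y) else b) else h b.
have baseE x : base (emb E x) = Some x.
  by rewrite /base; case: pickP => [y /eqP/emb_inj ->//|/(_ x)]; rewrite eqxx.
have f_in (Y : {set B}) x : bad Y -> emb E x \in Y -> f Y (emb E x) = (zeta x).2 (h @: Y).
  move=> Ybad xY; have [b [Yb bY bc]] := bad_spare Ybad.
  rewrite /f Yb (inj_eq Some_inj) xY baseE.
  by case: eqVneq => // bx; case/negP: bc; rewrite bx imset_f.
have f_out (Y : {set B}) b : bad Y -> b \notin Y -> f Y b = h b.
  move=> Ybad bY; have [c [Yc cY _]] := bad_spare Ybad.
  rewrite /f Yc (inj_eq Some_inj) (negbTE bY).
  by case: eqVneq bY => // <-; rewrite cY.
have hbad (Y : {set B}) : bad (h @: Y) = bad Y by apply: bad_act hG.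
have f_spare Y b : bad Y -> spare Y = Some b -> Some (f Y b) = spare (h @: Y).
  move=> Ybad Yb; rewrite /f Yb eqxx.
  by have [|c [-> _ _]] := @bad_spare (h @: Y); rewrite ?hbad.
have f_in_spare Y x : bad Y -> emb E x \in Y -> h (emb E x) \in X ->
    f Y (emb E x) \in h @: Y /\ spare (h @: Y) != Some (f Y (emb E x)).
  move=> Ybad xY hxX; have [zZ z1] := zetaP x hxX; rewrite f_in //.
  by apply: val_in; rewrite ?hbad // z1 mem_imset_perm.
have f_inj Y : bad Y -> {in dom Y &, injective (f Y)}.
  move=> Ybad; have [c [Yc cY cc]] := bad_spare Ybad.
  have := f_spare Y c Ybad Yc.
  have [|c' [Yc' cY' _]] := @bad_spare (h @: Y); first by rewrite hbad.
  rewrite Yc' => -[fc].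
  have caseD b : b \in dom Y -> [\/ b = c, (b \notin Y) |
      exists x, [/\ b = emb E x, b \in Y & h b \in X]].
    rewrite !inE Yc (inj_eq Some_inj) => /orP[/orP[|bY]|/eqP<-].
    - by case/andP=> /andP[bY /imsetP[x _ eb]] hb; constructor 3; exists x.
    - by constructor 2.
    - by constructor 1.
  move=> a b /caseD aD /caseD bD.
  case: aD => [->|aY|[x [-> aY ha]]]; case: bD => [->|bY|[y [-> bY hb]]] //.
  - rewrite fc f_out // => c'b; case/negP: bY.
    by rewrite -(mem_imset_perm h) -c'b.
  - rewrite fc => c'b; have [_] := f_in_spare Y y Ybad bY hb.
    by rewrite -c'b Yc' eqxx.
  - rewrite fc f_out // => c'a; case/negP: aY.
    by rewrite -(mem_imset_perm h) c'a.
  - by rewrite !f_out //; apply: perm_inj.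
  - have [+ _] := f_in_spare Y y Ybad bY hb => /[swap] <-.
    by rewrite f_out // mem_imset_perm (negbTE aY).
  - rewrite fc => c'a; have [_] := f_in_spare Y x Ybad aY ha.
    by rewrite c'a Yc' eqxx.
  - have [+ _] := f_in_spare Y x Ybad aY ha => /[swap] ->.
    by rewrite f_out // mem_imset_perm (negbTE bY).
  - have [xZ x1] := zetaP x ha; have [yZ y1] := zetaP y hb.
    rewrite !f_in // => /(val_inj (h @: Y)) eq_z.
    have: zeta x = zeta y.
      by apply: eq_z; rewrite ?hbad // inE ?xZ ?yZ ?x1 ?y1 mem_imset_perm.
    by move=> /(congr1 fst); rewrite x1 y1 => /perm_inj.
pose theta Y := ext (dom Y) (f Y).
have tP : twist h theta.
  move=> Y Ybad; split=> [b|].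
    rewrite inE => bY; rewrite /theta ext_in ?f_out //; first exact: f_inj.
    by rewrite !inE bY orbT.
  have [c [Yc _ _]] := bad_spare Ybad; rewrite Yc -(f_spare Y c) //= /theta ext_in //.
    exact: f_inj.
  by rewrite !inE Yc eqxx orbT.
have [s sP] := exists_relabels_by h theta.
have s_zeta x : h (emb E x) \in X -> s (generic_emb x) = zeta x.
  move=> hxX; have [zZ z1] := zetaP x hxX.
  rewrite [LHS]surjective_pairing [RHS]surjective_pairing.
  rewrite z1 (proj1 (sP (generic_emb x) set0)); congr (_, _); apply/ffunP => Y.
  rewrite -(imset_permKV h Y); move: (h^-1 @: Y) => {}Y.
  rewrite (proj2 (sP _ _)) ffunE /=; case: ifP => [/andP[xY Ybad]|/negbT out].
    rewrite /theta ext_in ?f_in //; first exact: f_inj.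
    by rewrite !inE xY imset_f ?hxX.
  by rewrite val_out // z1 // mem_imset_perm hbad.
exists (s, g).
  rewrite inE; apply/asboolP; split; last by exists h, theta.
  move=> x xK /=.
  have xZ : generic_emb x \in Z by apply: (fintype.subsetP KZ); apply: imset_f.
  have hx : h (emb E x) = emb E x by apply: (motions_fix hG).
  have xX : h (emb E x) \in X by rewrite hx; apply/imsetP; exists (generic_emb x).
  rewrite s_zeta //; have [zZ z1] := zetaP x xX.
  by apply: fst_inj => //; rewrite z1 hx.
apply/fintype.subsetP => z zZ /=.
have z1X := fstX z zZ.
have /imsetP[_ /imsetP[x _ ->] z1] := Xh _ z1X.
have hxX : h (emb E x) \in X by rewrite -z1.
apply/imsetP; exists (generic_emb x); first exact: imset_f.
rewrite s_zeta //; have [z'Z z'1] := zetaP x hxX.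
by apply: fst_inj => //; rewrite z'1.
Qed.

End Generic.

From mathcomp Require Import boolp classical_sets functions cardinality.

(** * The finite orbit *)

Section Orbit.

Variables (L : language) (T : Type).
Implicit Types (g f : lang_perm L) (S : interpretation L T).

Lemma relabel_id S : relabel (lang_id L) S = S.
Proof. by case: S. Qed.

Lemma relabel_comp g f S : relabel (lang_comp g f) S = relabel g (relabel f S).
Proof. by []. Qed.

Lemma relabelK g : cancel (@relabel L T g) (relabel (lang_inv g)).
Proof.
case=> SR SF; rewrite /relabel /=; congr Interpretation.
  by apply: functional_extensionality_dep => n; apply/funext => R; rewrite perm_funK.
by apply: functional_extensionality_dep => n; apply/funext => F; rewrite perm_funK.
Qed.

(** The orbit is finite although the group need not be, so only the permutation
    induced on the orbit is kept as the label of a language part. *)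
Record orbit_action (Gam : perm_group L) (S : interpretation L T) := OrbitAction {
  orbit_size : nat;
  orbit_int : 'I_orbit_size -> interpretation L T;
  orbit_base : 'I_orbit_size;
  label : lang_perm L -> {perm 'I_orbit_size};
  orbit_int_inj : injective orbit_int;
  orbit_int_base : orbit_int orbit_base = S;
  labelP : forall g i, Gam g -> orbit_int (label g i) = relabel g (orbit_int i)
}.

Variables (Gam : perm_group L) (S : interpretation L T) (O : orbit_action Gam S).

Lemma label_id : label O (lang_id L) = 1%g.
Proof.
apply/permP => i; apply: (orbit_int_inj (o := O)).
by rewrite labelP ?relabel_id ?perm1 //; apply: perm_group_id.
Qed.

Lemma label_comp g f : Gam g -> Gam f ->
  label O (lang_comp g f) = (label O f * label O g)%g.
Proof.
move=> gG fG; apply/permP => i; apply: (orbit_int_inj (o := O)).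
by rewrite permM !labelP //; apply: perm_group_comp.
Qed.

Lemma label_inv g : Gam g -> label O (lang_inv g) = (label O g)^-1%g.
Proof.
move=> gG; apply/permP => i; apply: (orbit_int_inj (o := O)).
rewrite labelP; last exact: perm_group_inv.
rewrite -{1}[i](permKV (label O g)) labelP // relabelK //.
Qed.

End Orbit.

Lemma finite_orbit_action (L : language) (Gam : perm_group L) (A : structure L) :
  finite_set (relabel_orbit Gam A) -> inhabited (orbit_action Gam (interp A)).
Proof.
case=> n /card_set_bijP[f [f_lt f_inj f_surj]].
have /choice[o oP] (i : 'I_n) : exists S, relabel_orbit Gam A S /\ f S = i.
  by have [S ? ?] := f_surj i (ltn_ord i); exists S.
have o_inj : injective o.
  by move=> i j eq_o; apply: val_inj => /=; rewrite -(proj2 (oP i)) eq_o (proj2 (oP j)).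
have o_onto S : relabel_orbit Gam A S -> exists i, o i = S.
  move=> AS; exists (Ordinal (f_lt S AS)); have [Ao fo] := oP (Ordinal (f_lt S AS)).
  by apply: f_inj; rewrite ?inE //; apply/mem_set.
have [|i0 oi0] := o_onto (interp A).
  by exists (lang_id L); [exact: perm_group_id | exact: relabel_id].
have /choice[lab labP] (g : lang_perm L) : exists p : {perm 'I_n},
    Gam g -> forall i, o (p i) = relabel g (o i).
  have [gG|] := pselect (Gam g); last by exists 1%g.
  have /choice[q qP] i : exists j, o j = relabel g (o i).
    apply: o_onto; have [[h hG <-] _] := oP i.
    by exists (lang_comp g h); [exact: perm_group_comp | exact: relabel_comp].
  have q_inj : injective q.
    move=> i j eq_q; apply: o_inj; apply: (can_inj (relabelK g)).
    by rewrite -!qP eq_q.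
  by exists (perm q_inj) => _ i; rewrite permE.
by constructor; apply: OrbitAction o_inj oi0 _ => g i /labP.
Qed.

(** * Local isomorphisms *)

Section LocalIso.

Variables (L : language) (Gam : perm_group L) (T : finType).
Variables (S : interpretation L T) (O : orbit_action Gam S).
Implicit Types (X : {set T}) (e : {perm T}) (g : lang_perm L).

Definition unary_val (S' : interpretation L T) (F : fun_symb L 1) (x : T) : {set T} :=
  [set y | `[< fun_int S' F [tuple x] y >]].

(** The set [X] need not be closed under the functions, hence function values are
    compared inside [X] only.  The equality of cardinalities makes up for this:
    when [X] is closed it forces the image of [X] to be closed as well. *)
Definition local_iso X e g : Prop :=
  [/\ forall n (R : rel_symb L n) (x : n.-tuple T), (forall i, tnth x i \in X) ->
        rel_int S R x <-> rel_int S (on_rel g n R) (map_tuple e x),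
      forall F x y, x \in X -> y \in X ->
        (y \in unary_val S F x) = (e y \in unary_val S (on_fun g 1 F) (e x))
    & forall F x, x \in X ->
        #|unary_val S F x| = #|unary_val S (on_fun g 1 F) (e x)|].

Definition local_iso_class X e (k : {perm 'I_(orbit_size O)}) : bool :=
  `[< exists g, [/\ Gam g, label O g = k & local_iso X e g] >].

Lemma local_iso_classP : local_isos local_iso_class.
Proof.
split.
- move=> X; apply/asboolP; exists (lang_id L); split; first exact: perm_group_id.
    exact: label_id.
  split=> [n R x _|F x y _ _|F x _]; rewrite ?perm1 //.
  suff -> : map_tuple (1%g : {perm T}) x = x by [].
  by apply: eq_from_tnth => i; rewrite tnth_map perm1.
- move=> X e k e' k' /asboolP[g [gG <- [gR gF gC]]] /asboolP[g' [g'G <- [g'R g'F g'C]]].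
  apply/asboolP; exists (lang_comp g' g); split; first exact: perm_group_comp.
    exact: label_comp.
  split=> [n R x xX|F x y xX yX|F x xX].
  + rewrite gR // g'R => [|i]; last by rewrite tnth_map imset_f.
    suff -> : map_tuple e' (map_tuple e x) = map_tuple (e * e')%g x by [].
    by apply: eq_from_tnth => i; rewrite !tnth_map permM.
  + by rewrite gF // g'F ?imset_f // !permM.
  + by rewrite gC // g'C ?imset_f // !permM.
- move=> X e k /asboolP[g [gG <- [gR gF gC]]].
  apply/asboolP; exists (lang_inv g); split; first exact: perm_group_inv.
    exact: label_inv.
  have eK x : x \in e @: X -> (e^-1)%g x \in X.
    by move=> /imsetP[y yX ->]; rewrite permK.
  split=> [n R x xX|F x y xX yX|F x xX].
  + rewrite (gR n (on_rel (lang_inv g) n R)) /= => [|i]; last by rewrite tnth_map eK.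
    rewrite Defs.perm_invK; suff -> : map_tuple e (map_tuple e^-1%g x) = x by [].
    by apply: eq_from_tnth => i; rewrite !tnth_map permKV.
  + by rewrite [RHS]gF ?eK //= Defs.perm_invK !permKV.
  + by rewrite [RHS]gC ?eK //= Defs.perm_invK !permKV.
- move=> X Y e k YX /asboolP[g [gG kg [gR gF gC]]]; apply/asboolP; exists g; split=> //.
  have {}YX := fintype.subsetP YX.
  by split=> *; [apply: gR | apply: gF | apply: gC]; auto.
- move=> X e e' k ee' /asboolP[g [gG kg [gR gF gC]]]; apply/asboolP; exists g; split=> //.
  split=> [n R x xX|F x y xX yX|F x xX].
  + rewrite gR //; suff -> : map_tuple e x = map_tuple e' x by [].
    by apply: eq_from_tnth => i; rewrite !tnth_map ee'.
  + by rewrite -!ee' // gF.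
  + by rewrite -!ee' // gC.
Qed.

Definition constants : {set T} :=
  [set x | `[< exists c : fun_symb L 0, fun_int S c [tuple] x >]].

End LocalIso.

(** * Irreducibility *)

Section Irreducible.

Variables (L : language) (Gam : perm_group L).
Hypothesis arity_le1 : forall (n : nat) (F : fun_symb L n), (n <= 1)%N.
Local Open Scope classical_set_scope.

Lemma sub_incl_embedding (A : structure L) (X : substructure A) :
  is_embedding Gam (sub_incl X).
Proof.
have [_] := substructureP Gam (sub_interp (sub_set X)).
by apply; split=> //; apply: sub_closed.
Qed.

Lemma sub_sub_incl_embedding (A : structure L) (X Y : substructure A)
  (XY : sub_set X `<=` sub_set Y) : is_embedding Gam (sub_sub_incl XY).
Proof.
have mapE n (x : n.-tuple X) :
    map_tuple val (map_tuple (vert_part (sub_sub_incl XY)) x) = map_tuple val x.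
  by apply: eq_from_tnth => i; rewrite !tnth_map.
have relE n (R : rel_symb L n) (x : n.-tuple X) : rel_of R x <->
    rel_of (A:=Y) R (map_tuple (vert_part (sub_sub_incl XY)) x).
  by rewrite /rel_of /= mapE.
have funE n (F : fun_symb L n) (x : n.-tuple X) :
    vert_part (sub_sub_incl XY) @` fun_of F x =
    fun_of (A:=Y) F (map_tuple (vert_part (sub_sub_incl XY)) x).
  rewrite /fun_of /= mapE; apply/seteqP; split=> [_ [y Fy <-]//|y Fy].
  have Xy : sub_set X (val y).
    by apply: sub_closed Fy => i; rewrite tnth_map; exact/set_mem/valP.
  by exists (exist (fun a => a \in sub_set X) (val y) (mem_set Xy)) => //; apply: val_inj.
split=> //.
  split=> [|n R x /relE//|n F x]; first exact: perm_group_id.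
  by rewrite funE.
by move=> x y /(congr1 val) /= /val_inj.
Qed.

(** With functions of arity at most one, the condition on function values of mixed
    tuples is void, and a free amalgamation is just a cover by two closed sets
    across which no relation holds. *)
Lemma irreducible_cover (C : structure L) (P1 P2 : set C) :
  irreducible Gam C -> fun_closed P1 -> fun_closed P2 -> P1 `|` P2 = setT ->
  (forall n (R : rel_symb L n) (x : n.-tuple C) i j, rel_of R x ->
     ~ P1 (tnth x i) -> ~ P2 (tnth x j) -> False) ->
  P1 = setT \/ P2 = setT.
Proof.
move=> irrC cl1 cl2 cover unrel; apply: contrapT => /not_orP[P1T P2T]; apply: irrC.
have clI : fun_closed (P1 `&` P2).
  by move=> n F x xP y Fy; split; [apply: cl1 Fy|apply: cl2 Fy] => i; have [] := xP i.
exists (Substructure cl1), (Substructure cl2), (Substructure clI), (@subIsetl _ P1 P2),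
  (@subIsetr _ P1 P2); split=> //.
have valE (P : set C) (clP : fun_closed P) :
    range (vert_part (sub_incl (Substructure clP))) = P.
  apply/seteqP; split=> [_ [x _ <-]|x Px]; first exact/set_mem/valP.
  by exists (exist (fun a => a \in P) x (mem_set Px)).
have mixed n (x : n.-tuple C) :
    is_mixed (sub_sub_incl (X := Substructure clI) (Y := Substructure cl1) (@subIsetl _ P1 P2))
      (sub_sub_incl (X := Substructure clI) (Y := Substructure cl2) (@subIsetr _ P1 P2))
      (sub_incl (Substructure cl1)) (sub_incl (Substructure cl2)) x ->
    exists i j, ~ P1 (tnth x i) /\ ~ P2 (tnth x j).
  move=> [[j [b1 b1I b1x]] [i [b2 b2I b2x]]]; exists i, j; split.
    move=> P1x; apply: b2I; have P2x : P2 (tnth x i).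
      by rewrite -b2x; exact/set_mem/valP.
    exists (exist (fun a => a \in P1 `&` P2) (tnth x i) (mem_set (conj P1x P2x))) => //.
    by apply: val_inj; rewrite /= -b2x.
  move=> P2x; apply: b1I; have P1x : P1 (tnth x j).
    by rewrite -b1x; exact/set_mem/valP.
  exists (exist (fun a => a \in P1 `&` P2) (tnth x j) (mem_set (conj P1x P2x))) => //.
  by apply: val_inj; rewrite /= -b1x.
split.
- split.
    by split; [exact: sub_sub_incl_embedding|exact: sub_sub_incl_embedding
      |exact: sub_incl_embedding|exact: sub_incl_embedding|].
  by rewrite !valE.
- by rewrite !valE cover.
- move=> n x /mixed[i [j [ni nj]]]; split=> [R /unrel/(_ ni nj)//|F].
  have := arity_le1 F; case: n F x i j ni nj => [|[|//]] F x i j; first by case: i.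
  rewrite (ord1 i) (ord1 j) => n1 n2 _.
  have : (P1 `|` P2) (tnth x ord0) by rewrite cover.
  by case.
Qed.

End Irreducible.

(** * Charts *)

Section Charts.

Variables (L : language) (Gam : perm_group L) (T : finType).
Variables (S : interpretation L T) (O : orbit_action Gam S).
Hypothesis arity_le1 : forall (n : nat) (F : fun_symb L n), (n <= 1)%N.
Hypothesis const_fixed : forall (g : lang_perm L) (c : fun_symb L 0),
  Gam g -> on_fun g 0 c = c.
Hypothesis const_singleton : forall c : fun_symb L 0,
  exists x : T, fun_int S c [tuple] = [set x]%classic.
Hypothesis const_unary : forall (c : fun_symb L 0) (F : fun_symb L 1) (x : T),
  fun_int S c [tuple] = [set x]%classic -> fun_int S F [tuple x] = classical_sets.set0.
Variable E : ext_system (constants S) (@local_iso_class _ _ _ _ O).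

(** A chart is a motion of the base inside the space, with its label; the structure
    [str c] which it carries is the corresponding relabelling of the base. *)
Definition chart := subg_of (motions E).
Implicit Types (c p : chart) (x y : T) (F : fun_symb L 1).

Definition motion c : {perm space E} := (sgval c).1.
Definition pos c x : space E := motion c (emb E x).
Definition str c : interpretation L T := orbit_int ((sgval c).2 (orbit_base O)).
Local Notation cval c F x := (unary_val (str c) F x).

Lemma pos_inj c : injective (pos c).
Proof. by move=> x y /perm_inj/emb_inj. Qed.

Lemma posM c p x : pos (c * p)%g x = motion p (pos c x).
Proof. by rewrite /pos /motion /= permM. Qed.

Lemma chart_label c : exists g, Gam g /\ label O g = (sgval c).2.
Proof.
have : local_iso_class (O:=O) finset.set0 1%g (sgval c).2.
  by apply: (motions_local (subgP c)) => x; rewrite inE.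
by move=> /asboolP[g [gG gl _]]; exists g.
Qed.

Lemma str1 : str 1%g = S.
Proof. by rewrite /str perm1 orbit_int_base. Qed.

Lemma str_label c g : Gam g -> label O g = (sgval c).2 -> str c = relabel g S.
Proof. by move=> gG gl; rewrite /str -gl labelP // orbit_int_base. Qed.

Lemma strM c p g : Gam g -> label O g = (sgval p).2 ->
  str (c * p)%g = relabel g (str c).
Proof. by move=> gG gl; rewrite /str /= permM -gl labelP. Qed.

Definition closed_in c (U : {set T}) : Prop :=
  forall F y, y \in U -> cval c F y \subset U.

(** Two charts agree around a position when they have the same unary functions on a
    closed set containing it; so a vertex determines everything that it
    generates.  Relations are left out: a motion between base vertices
    preserves them anyway. *)
Definition eqv c x c' x' : Prop := pos c x = pos c' x' /\
  exists U : {set T}, [/\ x \in U, closed_in c U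
    & forall y, y \in U -> exists y', pos c y = pos c' y' /\
        forall F, pos c @: cval c F y = pos c' @: cval c' F y'].

Lemma eqv_refl c x : eqv c x c x.
Proof.
split=> //; exists [set: T]%SET; split; first by rewrite finset.in_setT.
  by move=> F y _; apply: finset.subsetT.
by move=> y _; exists y.
Qed.

Lemma eqv_sym c x c' x' : eqv c x c' x' -> eqv c' x' c x.
Proof.
case=> xx' [U [xU Ucl UP]]; split=> //.
exists [set y' | [exists y in U, pos c y == pos c' y']]%SET; split.
- by rewrite inE; apply/existsP; exists x; rewrite xU xx' /=.
- move=> F y'; rewrite inE => /existsP[y /andP[yU /eqP yy']].
  have [y1 [yy1 yF]] := UP y yU; have {yy1} : y1 = y' by apply: (@pos_inj c'); rewrite -yy1.
  move=> eq1; subst y1; apply/fintype.subsetP => z' z'F.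
  have /imsetP[z zF z'z] : pos c' z' \in pos c @: cval c F y by rewrite yF imset_f.
  rewrite inE; apply/existsP; exists z; rewrite -z'z eqxx andbT.
  exact: (fintype.subsetP (Ucl F y yU)).
- move=> y'; rewrite inE => /existsP[y /andP[yU /eqP yy']]; exists y.
  have [y1 [yy1 yF]] := UP y yU; have {yy1} : y1 = y' by apply: (@pos_inj c'); rewrite -yy1.
  by move=> eq1; subst y1; split=> // F; rewrite yF.
Qed.

Lemma eqv_trans c x c' x' c'' x'' : eqv c x c' x' -> eqv c' x' c'' x'' -> eqv c x c'' x''.
Proof.
case=> xx' [U [xU Ucl UP]] [x'x'' [U' [x'U' U'cl U'P]]]; split; first by rewrite xx'.
exists [set y in U | [exists y' in U', pos c y == pos c' y']]%SET; split.
- by rewrite inE xU; apply/existsP; exists x'; rewrite x'U' xx' /=.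
- move=> F y; rewrite inE => /andP[yU /existsP[y' /andP[y'U' /eqP yy']]].
  have [y1 [yy1 yF]] := UP y yU; have {yy1} : y1 = y' by apply: (@pos_inj c'); rewrite -yy1.
  move=> eq1; subst y1; apply/fintype.subsetP => z zF.
  have /imsetP[z' z'F zz'] : pos c z \in pos c' @: cval c' F y' by rewrite -yF imset_f.
  rewrite inE (fintype.subsetP (Ucl F y yU)) //=.
  apply/existsP; exists z'; rewrite -zz' eqxx andbT.
  exact: (fintype.subsetP (U'cl F y' y'U')).
- move=> y; rewrite inE => /andP[yU /existsP[y' /andP[y'U' /eqP yy']]].
  have [y1 [yy1 yF]] := UP y yU; have {yy1} : y1 = y' by apply: (@pos_inj c'); rewrite -yy1.
  move=> eq1; subst y1; have [y'' [y'y'' y'F]] := U'P y' y'U'.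
  by exists y''; split=> [|F]; [rewrite yy' | rewrite yF y'F].
Qed.

Lemma motion_cval c p g F x : Gam g -> label O g = (sgval p).2 ->
  pos (c * p)%g @: cval (c * p)%g F x =
  motion p @: (pos c @: cval c (on_fun (lang_inv g) 1 F) x).
Proof.
move=> gG gl; rewrite -imset_comp (strM c gG gl).
by apply: eq_imset => y; rewrite posM.
Qed.

Lemma eqv_act c x c' x' p : eqv c x c' x' -> eqv (c * p)%g x (c' * p)%g x'.
Proof.
have [g [gG gl]] := chart_label p.
case=> xx' [U [xU Ucl UP]]; split; first by rewrite !posM xx'.
exists U; split=> // [F y yU|y yU]; first by rewrite (strM c gG gl); apply: Ucl.
have [y' [yy' yF]] := UP y yU; exists y'; rewrite !posM yy'; split=> // F.
by rewrite !(motion_cval _ _ _ gG gl) yF.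
Qed.

(** * The amalgam of all charts *)

Definition chart_class c x : {set T * chart} :=
  [set q : T * chart | `[< eqv c x q.2 q.1 >]]%SET.

Lemma mem_chart_class c x q : (q \in chart_class c x) = `[< eqv c x q.2 q.1 >].
Proof. by rewrite inE. Qed.

(** Equivalence classes are taken as sets, so that the quotient is a finite type. *)
Definition amalgam : finType :=
  {X : {set T * chart} | [exists q : T * chart, X == chart_class q.2 q.1]}.

Lemma chart_class_proof c x :
  [exists q : T * chart, chart_class c x == chart_class q.2 q.1].
Proof. by apply/existsP; exists (x, c). Qed.

Definition pt c x : amalgam := exist _ (chart_class c x) (chart_class_proof c x).

Lemma ptP c x c' x' : pt c x = pt c' x' <-> eqv c x c' x'.
Proof.
split=> [/(congr1 val)/= /setP/(_ (x', c'))|xx'].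
  rewrite !mem_chart_class (asboolT (eqv_refl c' x')) => /asboolP //.
apply/val_inj/setP => q; rewrite !mem_chart_class; apply: asbool_equiv_eq.
by split; apply: eqv_trans; [exact: eqv_sym|].
Qed.

Lemma pt_onto (w : amalgam) : exists c x, w = pt c x.
Proof.
have /existsP[[x c] /eqP wE] := valP w; exists c, x; exact: val_inj.
Qed.

Lemma pt_inj c : injective (pt c).
Proof. by move=> x y /ptP[/pos_inj]. Qed.

Definition amalgam_interp : interpretation L amalgam :=
  Interpretation
    (fun n (R : rel_symb L n) (w : n.-tuple amalgam) =>
       exists c (x : n.-tuple T), w = map_tuple (pt c) x /\ rel_int (str c) R x)
    (fun n (F : fun_symb L n) (w : n.-tuple amalgam) v =>
       exists c (x : n.-tuple T) y,
         [/\ w = map_tuple (pt c) x, v = pt c y & fun_int (str c) F x y]).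

Definition amalgam_structure : structure L := Structure amalgam_interp.
Local Notation W := amalgam_structure.

Lemma str_const c (F : fun_symb L 0) : fun_int (str c) F [tuple] = fun_int S F [tuple].
Proof.
have [g [gG gl]] := chart_label c; rewrite (str_label gG gl) /=.
by have /= -> := const_fixed F (perm_group_inv gG).
Qed.

Lemma cval_const c F x : x \in constants S -> cval c F x = finset.set0.
Proof.
rewrite inE => /asboolP[a ax]; have [y ay] := const_singleton a.
apply/setP => z; rewrite !inE; apply/asboolP.
have [g [gG gl]] := chart_label c; rewrite (str_label gG gl) /=.
by rewrite (@const_unary a) ?ay //; move: ax; rewrite ay => ->.
Qed.

Lemma pos_const c x : x \in constants S -> pos c x = emb E x.
Proof. exact: (motions_fix (subgP c)). Qed.

(** The group fixes the constants and they generate nothing, so the empty functions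
    of all charts agree around them. *)
Lemma pt_const c c' x : x \in constants S -> pt c x = pt c' x.
Proof.
move=> xK; apply/ptP; split; first by rewrite !pos_const.
exists [set x]%SET; split; first by rewrite inE.
  by move=> F y; rewrite inE => /eqP->; rewrite cval_const // finset.sub0set.
move=> y; rewrite inE => /eqP->; exists x; rewrite !pos_const //; split=> // F.
by rewrite !cval_const // !imset0.
Qed.

(** A function value of a vertex is visible in every chart that shows the vertex;
    this is what agreement on a closed set was asked for. *)
Lemma fun_pt n (F : fun_symb L n) c (x : n.-tuple T) v :
  fun_of (A:=W) F (map_tuple (pt c) x) v <->
  exists2 y, v = pt c y & fun_int (str c) F x y.
Proof.
split=> [|[y -> Fy]]; last by exists c, x, y.
case=> c' [x' [y' [xx' -> {v}]]]; have := arity_le1 F.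
case: n F x x' xx' => [|[|//]] F x x' xx' _.
  rewrite [x']tuple0 str_const => Fy; exists y'; last by rewrite [x]tuple0 str_const.
  by apply: pt_const; rewrite inE; apply/asboolP; exists F.
case/tupleP: x xx' => x t; rewrite [t]tuple0 {t}.
case/tupleP: x' => x' t; rewrite [t]tuple0 {t}.
move=> /(congr1 (@tnth _ _ ^~ ord0)); rewrite !tnth_map !(tnth_nth x) /= => /ptP/eqv_sym.
case=> x'x [U [x'U Ucl UP]] Fy'.
have [x1 [x'x1 xF]] := UP x' x'U.
have {x'x1} : x1 = x by apply: (@pos_inj c); rewrite -x'x1.
move=> eq1; subst x1; have y'F : y' \in cval c' F x' by rewrite inE; apply/asboolP.
have /imsetP[y yF y'y] : pos c' y' \in pos c @: cval c F x by rewrite -xF imset_f.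
exists y; last by move: yF; rewrite inE => /asboolP.
apply/ptP; split=> //; exists U; split=> //; exact: (fintype.subsetP (Ucl F x' x'U)).
Qed.

(** * Automorphisms of the amalgam *)

Definition act_vert p (w : amalgam) : amalgam :=
  let q := xchoose (existsP (valP w)) in pt (q.2 * p)%g q.1.

Lemma act_pt p c x : act_vert p (pt c x) = pt (c * p)%g x.
Proof.
rewrite /act_vert; set q := xchoose _; apply/ptP/eqv_act/eqv_sym/ptP.
by apply: val_inj; apply/eqP; apply: (xchooseP (existsP (valP (pt c x)))).
Qed.

Lemma act_vertM p q w : act_vert (p * q)%g w = act_vert q (act_vert p w).
Proof. by have [c [x ->]] := pt_onto w; rewrite !act_pt mulgA. Qed.

Lemma act_vertK p : cancel (act_vert p) (act_vert p^-1%g).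
Proof.
move=> w; rewrite -act_vertM mulgV; have [c [x ->]] := pt_onto w.
by rewrite act_pt mulg1.
Qed.

Lemma act_vertVK p : cancel (act_vert p^-1%g) (act_vert p).
Proof. by move=> w; rewrite -{1}[p]invgK act_vertK. Qed.

Lemma act_hom p g n : Gam g -> label O g = (sgval p).2 ->
  (forall (R : rel_symb L n) (w : n.-tuple W), rel_of R w ->
     rel_of (A:=W) (on_rel g n R) (map_tuple (act_vert p) w)) /\
  (forall (F : fun_symb L n) (w : n.-tuple W) v, fun_of F w v ->
     fun_of (A:=W) (on_fun g n F) (map_tuple (act_vert p) w) (act_vert p v)).
Proof.
move=> gG gl; have act_map c (x : n.-tuple T) :
    map_tuple (act_vert p) (map_tuple (pt c) x) = map_tuple (pt (c * p)%g) x.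
  by apply: eq_from_tnth => i; rewrite !tnth_map act_pt.
split=> [R _ [c [x [-> Rx]]]|F _ _ [c [x [y [-> -> Fy]]]]].
  exists (c * p)%g, x; rewrite act_map (strM c gG gl) /=.
  by rewrite perm_funK.
exists (c * p)%g, x, y; rewrite act_map act_pt (strM c gG gl) /=.
by rewrite perm_funK.
Qed.

Lemma act_automorphism p g : Gam g -> label O g = (sgval p).2 ->
  is_automorphism Gam (@LMap L W W g (act_vert p)).
Proof.
move=> gG gl; have gVG := perm_group_inv gG.
have gVl : label O (lang_inv g) = (sgval p^-1%g).2 by rewrite label_inv // gl.
have hom n := act_hom n gG gl; have homV n := act_hom n gVG gVl.
have mapK n (w : n.-tuple W) :
    map_tuple (act_vert p^-1%g) (map_tuple (act_vert p) w) = w.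
  by apply: eq_from_tnth => i; rewrite !tnth_map act_vertK.
split; last by exists (act_vert p^-1%g); [exact: act_vertK | exact: act_vertVK].
split=> /=.
- split=> //= [n R x|n F x _ [v Fv <-]]; first exact: (proj1 (hom n)).
  exact: (proj2 (hom n)).
- exact: can_inj (act_vertK p).
- move=> n R w; split=> [|/(proj1 (homV n))]; first exact: (proj1 (hom n)).
  by rewrite mapK /= perm_funK.
- move=> n F w; apply/seteqP; split=> [_ [v Fv <-]|v]; first exact: (proj2 (hom n)).
  move=> /(proj2 (homV n)); rewrite mapK /= perm_funK => Fv.
  by exists (act_vert p^-1%g v) => //; rewrite act_vertVK.
Qed.

(** * Embedding the base structure *)

Definition base_structure : structure L := Structure S.
Local Notation A := base_structure.

Lemma pos1 x : pos 1%g x = emb E x.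
Proof. by rewrite /pos /motion perm1. Qed.

(** On a set closed in the chart, a local isomorphism into the base is compatible
    with all function values: it maps values to values, and the numbers of
    values agree. *)
Lemma eqv_local c (U : {set T}) (e : {perm T}) g :
  Gam g -> label O g = (sgval c).2 -> local_iso S U e g -> closed_in c U ->
  {in U, forall y, pos c y = emb E (e y)} -> {in U, forall y, pt c y = pt 1%g (e y)}.
Proof.
move=> gG gl [_ gF gC] Ucl Ue y yU; apply/ptP; split; first by rewrite pos1 Ue.
exists U; split=> // {yU}y yU; exists (e y); rewrite pos1 Ue //; split=> // F.
have sub : cval c F y \subset U by apply: Ucl.
have -> : pos c @: cval c F y = emb E @: (e @: cval c F y).
  by rewrite -imset_comp; apply: eq_in_imset => z zF; rewrite Ue // (fintype.subsetP sub).
rewrite (eq_imset (g := emb E) _ pos1) str1.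
rewrite (str_label gG gl) in sub *.
(* The chart carries the structure relabelled by g, so its symbol F is the symbol
   g^-1 F of the base. *)
have FE : on_fun g 1 (on_fun (lang_inv g) 1 F) = F by rewrite /= Defs.perm_invK.
suff -> : e @: unary_val (relabel g S) F y = unary_val S F (e y) by [].
apply/eqP; rewrite eqEcard; apply/andP; split.
  apply/fintype.subsetP => _ /imsetP[z zF ->]; rewrite -[in X in _ \in X]FE -gF //.
  exact: (fintype.subsetP sub).
by rewrite card_imset; [rewrite -{1}FE -gC | apply: perm_inj].
Qed.

Lemma chart_local c (U : {set T}) :
  (forall y, y \in U -> exists x, pos c y = emb E x) ->
  exists (e : {perm T}) g, [/\ Gam g, label O g = (sgval c).2, local_iso S U e g
    & {in U, forall y, pos c y = emb E (e y)}].
Proof.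
move=> Uc; have /choice[f fP] y : exists x, y \in U -> pos c y = emb E x.
  by have [/Uc[x]|] := boolP (y \in U); [exists x | exists y].
have f_inj : {in U &, injective f}.
  by move=> y z yU zU eq_f; apply: (@pos_inj c); rewrite !fP ?eq_f.
have eP : {in U, forall y, pos c y = emb E (ext U f y)}.
  by move=> y yU; rewrite ext_in // fP.
have /asboolP[g [gG gl gU]] := motions_local (subgP c) eP.
by exists (ext U f), g.
Qed.

Lemma map_pt_onto n c (w : n.-tuple amalgam) :
  (forall i, exists x, tnth w i = pt c x) -> exists x : n.-tuple T, w = map_tuple (pt c) x.
Proof.
move=> /choice[f fP]; exists (mktuple f).
by apply: eq_from_tnth => i; rewrite tnth_map tnth_mktuple.
Qed.

(** A relation between base vertices that is inherited from another chart already
    holds in the base, since the transition from that chart is a local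
    isomorphism. *)
Lemma rel_pt1 n (R : rel_symb L n) (x : n.-tuple T) :
  rel_of (A:=W) R (map_tuple (pt 1%g) x) <-> rel_int S R x.
Proof.
split=> [[c [y [xy Ry]]]|Rx]; last by exists 1%g, x; rewrite str1.
have xyP i : pos c (tnth y i) = emb E (tnth x i).
  have /ptP[] : pt 1%g (tnth x i) = pt c (tnth y i).
    by have := congr1 (fun w => tnth w i) xy; rewrite !tnth_map.
  by rewrite pos1.
have [|e [g [gG gl [gR _ _] eP]]] := @chart_local c [set tnth y i | i in 'I_n].
  by move=> _ /imsetP[i _ ->]; exists (tnth x i).
have -> : x = map_tuple e y.
  apply: eq_from_tnth => i; apply: (@emb_inj _ _ _ _ E).
  by rewrite tnth_map -eP ?xyP ?imset_f.
move: Ry; rewrite (str_label gG gl) /= => /gR; rewrite Defs.perm_invK.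
by apply=> i; rewrite imset_f.
Qed.

Lemma fun_pt1 n (F : fun_symb L n) (x : n.-tuple T) y :
  fun_of (A:=W) F (map_tuple (pt 1%g) x) (pt 1%g y) <-> fun_int S F x y.
Proof.
split=> [/fun_pt[z /pt_inj->]|Fy]; first by rewrite str1.
by apply/fun_pt; exists y; rewrite ?str1.
Qed.

Definition psi : lmap A W := @LMap L A W (lang_id L) (pt 1%g).

Lemma psiP : is_embedding Gam psi.
Proof.
have funE n (F : fun_symb L n) (x : n.-tuple A) :
    (vert_part psi @` fun_of F x)%classic = fun_of (A:=W) F (map_tuple (pt 1%g) x).
  apply/seteqP; split=> [_ [y Fy <-]|v /fun_pt[y -> Fy]]; first exact/fun_pt1.
  by exists y => //; rewrite str1 in Fy.
split=> //.
- split=> [|n R x Rx|n F x]; first exact: perm_group_id.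
    exact/rel_pt1.
  by rewrite funE.
- exact: (@pt_inj 1%g).
- by move=> n R x; split=> [Rx|/rel_pt1//]; apply/rel_pt1.
Qed.

(** * Faithfulness *)

Lemma copy_closed c : fun_closed (A:=W) (range (pt c))%classic.
Proof.
move=> n F w wc v; have [|x ->] := @map_pt_onto n c w.
  by move=> i; have [x _ <-] := wc i; exists x.
by case/fun_pt => y -> _; exists y.
Qed.

Definition constant_points : set W :=
  [set pt 1%g x | x in [set x | x \in constants S]]%classic.

Lemma constant_points_closed : fun_closed constant_points.
Proof.
move=> n F; have := arity_le1 F; case: n F => [|[|//]] F _ w wK v.
  rewrite [w]tuple0 -[[tuple]](tuple0 (map_tuple (pt 1%g) [tuple])).
  case/fun_pt => y ->; rewrite str1 => Fy.
  by exists y => //=; rewrite inE; apply/asboolP; exists F.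
have [x xK wx] := wK ord0; have -> : w = map_tuple (pt 1%g) [tuple x].
  by apply: eq_from_tnth => i; rewrite (ord1 i) -wx.
case/fun_pt => y -> Fy; have : y \in cval 1%g F x by rewrite inE; apply/asboolP.
by rewrite cval_const // inE.
Qed.

(** The vertices [v] such that [u] belongs to the substructure generated by [v]. *)
Definition above (u : W) : set W :=
  [set v : W | forall U, fun_closed U -> U v -> U u]%classic.

Lemma not_above_closed (C : substructure W) (u : W) : ~ constant_points u ->
  fun_closed (A:=C) [set x | ~ above u (val x)]%classic.
Proof.
move=> uK n F x xu y Fy; have := arity_le1 F; case: n F x xu Fy => [|[|//]] F x xu Fy _.
  move=> uy; apply: uK; apply: uy; first exact: constant_points_closed.
  by apply: constant_points_closed Fy; case.
move=> uy; apply: (xu ord0) => U Ucl Ux; apply: uy => //; apply: Ucl Fy => i.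
by rewrite tnth_map (ord1 i).
Qed.

(** The vertices not generating [u] and those not generating [v] are closed.  If
    they do not split [C] freely, then one vertex, or the vertices of one related
    tuple, generate both; these lie in one chart, and charts are closed.
    Constants are treated apart, being generated by every vertex and visible in
    every chart. *)
Lemma common_chart (C : substructure W) (u v : W) : irreducible Gam C ->
  sub_set C u -> sub_set C v -> exists c x y, u = pt c x /\ v = pt c y.
Proof.
move=> irrC uC vC.
have [[x xK <-]|uK] := pselect (constant_points u).
  by have [c [y ->]] := pt_onto v; exists c, x, y; split=> //; apply: pt_const.
have [[x xK <-]|vK] := pselect (constant_points v).
  by have [c [y ->]] := pt_onto u; exists c, y, x; split=> //; apply: pt_const.
apply: contrapT => no_chart.
have no_copy c a b : above u a -> above v b ->
    range (pt c)%classic a -> range (pt c) b -> False.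
  move=> au bv ac bc; apply: no_chart.
  have [x _ <-] := au _ (@copy_closed c) ac; have [y _ <-] := bv _ (@copy_closed c) bc.
  by exists c, x, y.
have [|||||] := @irreducible_cover L Gam arity_le1 C
  [set x | ~ above u (val x)]%classic [set x | ~ above v (val x)]%classic irrC.
- exact: not_above_closed.
- exact: not_above_closed.
- apply/seteqP; split=> // x _; have [xu|] := pselect (above u (val x)); last by left.
  right=> xv; have [c [y xE]] := pt_onto (val x).
  by apply: (no_copy c _ _ xu xv); exists y.
- move=> n R x i j [c [y [xE _]]] /contrapT ui /contrapT vj.
  have x_copy k : range (pt c) (val (tnth x k)).
    by exists (tnth y k) => //; have := congr1 (fun w => tnth w k) xE; rewrite !tnth_map.
  exact: no_copy ui vj (x_copy i) (x_copy j).
- move/seteqP => [_ /(_ (exist (fun a => a \in sub_set C) u (mem_set uC)) I)].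
  by apply=> U _.
- move/seteqP => [_ /(_ (exist (fun a => a \in sub_set C) v (mem_set vC)) I)].
  by apply=> U _.
Qed.

Hypothesis faithE : pair_faithful E.

(** The positions of [C] are pairwise in copies, hence in one copy, which an
    automorphism moves onto the base.  The vertices of [C] seen in one chart
    form a closed set there, so a local isomorphism identifies them with base
    vertices, and not merely their positions. *)
Lemma amalgam_faithful : irreducible_structure_faithful psiP.
Proof.
move=> C irrC.
pose Z : {set space E} :=
  [set b | `[< exists c x, sub_set C (pt c x) /\ b = pos c x >]]%SET.
have [||h hG /fintype.subsetP Zh] := @faithE Z.
- apply/fintype.subsetP => _ /imsetP[x xK ->]; rewrite inE; apply/asboolP.
  exists 1%g, x; rewrite pos1; split=> //.
  move: (xK); rewrite inE => /asboolP[a ax].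
  apply: (@sub_closed _ _ C 0 a [tuple]) => [[//]|].
  by rewrite -[[tuple]](tuple0 (map_tuple (pt 1%g) [tuple])); apply/fun_pt1.
- have ZP b : b \in Z -> exists c x, sub_set C (pt c x) /\ b = pos c x.
    by rewrite inE => /asboolP.
  move=> a b /ZP[c [x [Cx ->]]] /ZP[c' [y [Cy ->]]].
  have [c'' [x' [y' [/ptP[-> _] /ptP[-> _]]]]] := common_chart irrC Cx Cy.
  exists (sgval c''); first exact: subgP.
  by apply/fintype.subsetP => z /set2P[->|->]; apply: imset_f; apply: imset_f.
pose p : chart := (subg (motions E) h)^-1%g.
have motion_p b : motion p (h.1 b) = b.
  by rewrite /motion /= subgK //= permK.
have [g [gG gl]] := chart_label p.
exists (@LMap L W W g (act_vert p)); split; first exact: act_automorphism.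
move=> _ [w Cw <-] /=; have [c [x wE]] := pt_onto w; rewrite wE act_pt.
pose U : {set T} := [set y | `[< sub_set C (pt c y) >]]%SET.
have Ucl : closed_in (c * p)%g U.
  move=> F y; rewrite inE => /asboolP Cy; apply/fintype.subsetP => z.
  rewrite (strM c gG gl) inE => /asboolP Fz; rewrite inE; apply/asboolP.
  have Cpt i : sub_set C (tnth (map_tuple (pt c) [tuple y]) i) by rewrite (ord1 i).
  apply: (sub_closed (F := on_fun (lang_inv g) 1 F) Cpt (t := pt c z)).
  by apply/fun_pt; exists z.
have [|e [g' [g'G g'l g'U eP]]] := @chart_local (c * p)%g U.
  move=> y; rewrite inE => /asboolP Cy.
  have /Zh/imsetP[_ /imsetP[x' _ ->] yE] : pos c y \in Z.
    by rewrite inE; apply/asboolP; exists c, y.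
  by exists x'; rewrite posM yE motion_p.
have xU : x \in U by rewrite inE; apply/asboolP; rewrite -wE.
by rewrite (eqv_local g'G g'l g'U Ucl eP xU); exists (e x).
Qed.

(** * Extending partial automorphisms *)

Local Notation D := (image_structure psiP).

(** A substructure of the embedded base consists of elements of iterated subtypes;
    all computations are carried out with the vertices of the base below them. *)
Definition under (X : substructure D) : {set T} :=
  [set x | `[< exists x' : X, val (val x') = pt 1%g x >]]%SET.

Lemma underP (X : substructure D) x :
  reflect (exists x' : X, val (val x') = pt 1%g x) (x \in under X).
Proof. by rewrite inE; apply: asboolP. Qed.

Lemma under_onto (X : substructure D) (x' : X) : exists x, val (val x') = pt 1%g x.
Proof. by have [x _ xx'] := set_mem (valP (val x')); exists x. Qed.

Lemma under_lift (X : substructure D) n (x : n.-tuple T) :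
  (forall i, tnth x i \in under X) ->
  exists x' : n.-tuple X, forall i, val (val (tnth x' i)) = pt 1%g (tnth x i).
Proof.
move=> xX; have /choice[h hP] i : exists x' : X, val (val x') = pt 1%g (tnth x i).
  exact/underP.
by exists (mktuple h) => i; rewrite tnth_mktuple.
Qed.

Lemma rel_under (X : substructure D) n (R : rel_symb L n)
    (x' : n.-tuple X) (x : n.-tuple T) :
  (forall i, val (val (tnth x' i)) = pt 1%g (tnth x i)) ->
  rel_of R x' <-> rel_int S R x.
Proof.
move=> xx'; rewrite -rel_pt1 {1}/rel_of /= {1}/rel_of /=.
suff -> : map_tuple val (map_tuple val x') = map_tuple (pt 1%g) x by [].
by apply: eq_from_tnth => i; rewrite !tnth_map.
Qed.

Lemma fun_under (X : substructure D) n (F : fun_symb L n) (x' : n.-tuple X) (y' : X)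
    (x : n.-tuple T) y :
  (forall i, val (val (tnth x' i)) = pt 1%g (tnth x i)) -> val (val y') = pt 1%g y ->
  fun_of F x' y' <-> fun_int S F x y.
Proof.
move=> xx' yy'; rewrite -fun_pt1 {1}/fun_of /= {1}/fun_of /= yy'.
suff -> : map_tuple val (map_tuple val x') = map_tuple (pt 1%g) x by [].
by apply: eq_from_tnth => i; rewrite !tnth_map.
Qed.

Lemma under_closed (X : substructure D) n (F : fun_symb L n) (x : n.-tuple T) y :
  (forall i, tnth x i \in under X) -> fun_int S F x y -> y \in under X.
Proof.
move=> /under_lift[x' xx'] Fy; apply/underP.
pose yD : D := exist (fun w => w \in sub_set D) (pt 1%g y)
  (mem_set (ex_intro2 _ _ y I erefl)).
suff Xy : sub_set X yD by exists (exist (fun w => w \in sub_set X) yD (mem_set Xy)).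
have x'X i : sub_set X (tnth (map_tuple val x') i).
  by rewrite tnth_map; exact/set_mem/valP.
apply: (sub_closed (F := F) x'X); rewrite /fun_of /=.
have -> : map_tuple val (map_tuple val x') = map_tuple (pt 1%g) x.
  by apply: eq_from_tnth => i; rewrite !tnth_map.
exact/fun_pt1.
Qed.

Section Lift.

Variables (X Y : substructure D) (f : lmap X Y).

Definition under_map (x : T) : T :=
  odflt x [pick y | `[< exists x' : X, val (val x') = pt 1%g x /\
                        val (val (vert_part f x')) = pt 1%g y >]].

Lemma under_mapE (x' : X) x : val (val x') = pt 1%g x ->
  val (val (vert_part f x')) = pt 1%g (under_map x).
Proof.
move=> xx'; have [y yy'] := under_onto (vert_part f x').
rewrite /under_map; case: pickP => [z /asboolP[x1 [x1x <-]] |/(_ y)/asboolP[]].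
  by congr (val (val (vert_part f _))); do 2!apply: val_inj; rewrite xx' x1x.
by exists x'.
Qed.

Definition under_perm : {perm T} := ext (under X) under_map.

Definition hat_chart : chart :=
  subg (motions E) (lift E (under X) under_perm (label O (lang_part f)),
                 label O (lang_part f)).

Definition hat : lmap W W := @LMap L W W (lang_part f) (act_vert hat_chart).

Hypothesis isof : is_isomorphism Gam f.

Lemma under_map_inj : {in under X &, injective under_map}.
Proof.
have [[_ f_inj _ _] _] := isof.
move=> x y /underP[x' xx'] /underP[y' yy'] eq_f; apply: (@pt_inj 1%g).
rewrite -xx' -yy'; congr (val (val _)); apply: f_inj; do 2!apply: val_inj.
by rewrite (under_mapE xx') (under_mapE yy') eq_f.
Qed.

Lemma under_perm_in : {in under X, under_perm =1 under_map}.
Proof. exact: ext_in under_map_inj. Qed.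

Lemma under_map_im : under_map @: under X = under Y.
Proof.
apply/setP => y; apply/imsetP/underP => [[x /underP[x' xx'] ->]|[y' yy']].
  by exists (vert_part f x'); apply: under_mapE.
have [_ [f' _ f'K]] := isof; have [x xx'] := under_onto (f' y').
exists x; first by apply/underP; exists (f' y').
by apply: (@pt_inj 1%g); rewrite -(under_mapE xx') f'K.
Qed.

Lemma under_perm_im : under_perm @: under X = under Y.
Proof. by rewrite -under_map_im; apply: eq_in_imset => x /under_perm_in. Qed.

Lemma under_perm_tuple n (x' : n.-tuple X) (x : n.-tuple T) :
  (forall i, val (val (tnth x' i)) = pt 1%g (tnth x i)) ->
  forall i, val (val (tnth (map_tuple (vert_part f) x') i)) =
            pt 1%g (tnth (map_tuple under_perm x) i).
Proof.
move=> xx' i; rewrite !tnth_map (under_mapE (xx' i)) under_perm_in //.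
by apply/underP; exists (tnth x' i).
Qed.

Lemma fun_under_perm n (F : fun_symb L n) (x : n.-tuple T) y :
  (forall i, tnth x i \in under X) -> y \in under X ->
  fun_int S F x y <->
  fun_int S (on_fun (lang_part f) n F) (map_tuple under_perm x) (under_perm y).
Proof.
have [[_ f_inj _ funE] _] := isof.
move=> /under_lift[x' xx'] yX; have /underP[y' yy'] := yX.
rewrite -(fun_under F xx' yy').
rewrite -(fun_under _ (under_perm_tuple xx') (y' := vert_part f y')); last first.
  by rewrite (under_mapE yy') under_perm_in.
by rewrite -funE; split=> [Fy|[z Fz /f_inj<-//]]; exists y'.
Qed.

(** Both substructures are closed, so a partial automorphism carries the set of all
    function values of a vertex onto that of its image; in particular their
    numbers agree, as a local isomorphism requires. *)
Lemma under_perm_val (F : fun_symb L 1) x : x \in under X ->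
  under_perm @: unary_val S F x =
  unary_val S (on_fun (lang_part f) 1 F) (under_perm x).
Proof.
move=> xX; have x1 i : tnth [tuple x] i \in under X by rewrite (ord1 i).
have mapx : map_tuple under_perm [tuple x] = [tuple under_perm x].
  by apply: val_inj.
apply/setP => y; apply/imsetP/idP => [[z zF ->]|yF].
  move: zF; rewrite inE => /asboolP Fz; rewrite inE; apply/asboolP.
  have zX := under_closed x1 Fz.
  by move/(fun_under_perm F x1 zX): Fz; rewrite mapx.
move: yF; rewrite inE => /asboolP Fy.
have : y \in under Y.
  apply: under_closed Fy => i; rewrite (ord1 i) /=.
  by rewrite -under_perm_im; apply: imset_f.
rewrite -under_perm_im => /imsetP[z zX yz]; exists z => //.
by rewrite inE; apply/asboolP/(fun_under_perm F x1 zX); rewrite mapx -yz.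
Qed.

Lemma under_local_iso : local_iso S (under X) under_perm (lang_part f).
Proof.
have [[_ _ relE _] _] := isof.
split=> [n R x xX|F x y xX yX|F x xX].
- have [x' xx'] := under_lift xX.
  by rewrite -(rel_under R xx') relE (rel_under _ (under_perm_tuple xx')).
- by rewrite -under_perm_val // mem_imset //; apply: perm_inj.
- by rewrite -under_perm_val // card_imset //; apply: perm_inj.
Qed.

Lemma under_admissible :
  admissible (constants S) (@local_iso_class _ _ _ _ O)
    (under X) under_perm (label O (lang_part f)).
Proof.
have [[[fG _ _] _ _ _] _] := isof.
have KX : constants S \subset under X.
  apply/fintype.subsetP => x; rewrite inE => /asboolP[a ax].
  by apply: under_closed ax => -[].
split=> // [x xK|]; last first.
  by apply/asboolP; exists (lang_part f); split=> //; apply: under_local_iso.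
have xX := fintype.subsetP KX x xK; move: xK; rewrite inE => /asboolP[a ax].
have a0 i : tnth [tuple] i \in under X by case: i.
move/(fun_under_perm a a0 xX): (ax); rewrite const_fixed // tuple0.
by have [y ay] := const_singleton a; move: ax; rewrite ay => -> ->.
Qed.

Lemma sgval_hat_chart :
  sgval hat_chart = (lift E (under X) under_perm (label O (lang_part f)),
                     label O (lang_part f)).
Proof. exact/subgK/lift_in/under_admissible. Qed.

Lemma hat_automorphism : is_automorphism Gam hat.
Proof.
have [[[fG _ _] _ _ _] _] := isof.
by apply: act_automorphism; rewrite ?sgval_hat_chart.
Qed.

Lemma hat_extends : extends f hat.
Proof.
have [[[fG _ _] _ _ _] _] := isof; split=> //= x'.
have [x xx'] := under_onto x'; rewrite xx' (under_mapE xx') act_pt mul1g.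
have xX : x \in under X by apply/underP; exists x'.
have fl : label O (lang_part f) = (sgval hat_chart).2 by rewrite sgval_hat_chart.
rewrite (eqv_local fG fl under_local_iso _ _ xX) ?under_perm_in //.
  move=> F y yX; apply/fintype.subsetP => z; rewrite inE => /asboolP.
  rewrite (str_label fG fl) /=; apply: under_closed => i.
  by rewrite (ord1 i).
by move=> y yX; rewrite /pos /motion sgval_hat_chart (lift_emb E under_admissible).
Qed.

End Lift.

(** Each of the steps from a partial map to an automorphism is functorial: the
    extension to a permutation of the base, the lift to the group, and the
    action of the group on the amalgam. *)
Lemma hat_comp (X Y Z : substructure D) (f : lmap X Y) (g : lmap Y Z) :
  is_isomorphism Gam f -> is_isomorphism Gam g ->
  hat (lmap_comp g f) = lmap_comp (hat g) (hat f).
Proof.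
move=> isof isog; have [[[fG _ _] _ _ _] _] := isof; have [[[gG _ _] _ _ _] _] := isog.
rewrite /hat /lmap_comp /=; congr LMap; apply/funext => w /=.
rewrite -act_vertM; congr (act_vert _ w).
have adm := under_admissible isof; have adm' := under_admissible isog.
rewrite /hat_chart -subgM ?lift_in //; congr subg.
have -> : under_perm (lmap_comp g f) = (under_perm f * under_perm g)%g.
  rewrite /under_perm -(under_map_im isof) -ext_comp; first apply: eq_ext => x.
  - move=> /underP[x' xx']; apply: (@pt_inj 1%g).
    rewrite -(under_mapE (lmap_comp g f) xx') /=.
    by rewrite (under_mapE g (under_mapE f xx')).
  - exact: under_map_inj.
  - by rewrite (under_map_im isof); apply: under_map_inj.
rewrite /= label_comp // lift_comp ?(under_perm_im isof) //.
Qed.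

Lemma amalgam_coherent : coherent_extension_property psiP.
Proof.
exists hat; split=> [X Y f isof|X Y Z f g isof isog]; last exact: hat_comp.
by split; [exact: hat_automorphism | exact: hat_extends].
Qed.

Lemma amalgam_extension : extension_property psiP.
Proof.
by move=> X Y f isof; exists (hat f); split; [exact: hat_automorphism | exact: hat_extends].
Qed.

End Charts.

(** * Finite structures as finite types *)

(** The finite type has to share its countable structure with the given one, as
    the structures compared in the theorem depend on it. *)
Lemma finite_countType (V : countType) :
  finite_set [set: V] -> exists T : finType, (T : countType) = V.
Proof.
move=> /finite_seqP[s sT].
have axs : Finite.axiom (undup s).
  move=> x; rewrite count_uniq_mem ?undup_uniq // mem_undup.
  by have : [set: V]%classic x by []; rewrite sT /= => ->.
pose T : finType := HB.pack (Countable.sort V) (isFinite.Build V axs).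
by exists T; rewrite /T; case: V s sT axs T.
Qed.

Lemma finite_base_witness (L : language) (Gam : perm_group L) (T : finType)
    (S : interpretation L T) :
  (forall (n : nat) (F : fun_symb L n), (n <= 1)%N) ->
  (forall (g : lang_perm L) (c : fun_symb L 0), Gam g -> on_fun g 0 c = c) ->
  (forall c : fun_symb L 0, exists x : T, fun_int S c [tuple] = [set x]%classic) ->
  (forall (c : fun_symb L 0) (F : fun_symb L 1) (x : T),
     fun_int S c [tuple] = [set x]%classic ->
     fun_int S F [tuple x] = classical_sets.set0) ->
  orbit_action Gam S ->
  exists B : structure L,
    finite_structure B /\ faithful_coherent_EPPA_witness Gam (Structure S) B.
Proof.
move=> arity_le1 const_fixed const_singleton const_unary O.
pose E := generic_system (parity_system (constants S) (@local_iso_classP _ _ _ _ O)).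
have faithE : pair_faithful E by apply: generic_pair_faithful.
exists (amalgam_structure E); split; first exact: finite_finset.
split; [exact: finite_finset | exact: finite_finset |].
exists (psi E), (psiP arity_le1 const_fixed const_singleton const_unary E); split.
- exact: amalgam_extension.
- exact: amalgam_coherent.
- exact: amalgam_faithful.
Qed.

Local Open Scope classical_set_scope.

Theorem theorem12p6 (L : language) (Gam : perm_group L) (A : structure L)
  (arity_le1 : forall (n : nat) (F : fun_symb L n), (n <= 1)%N)
  (finA : finite_structure A)
  (const_fixed : forall (g : lang_perm L) (c : fun_symb L 0),
     Gam g -> on_fun g 0 c = c)
  (const_finite : finite_set [set: fun_symb L 0])
  (const_singleton : forall c : fun_symb L 0,
     exists x : A, fun_of c [tuple] = [set x])
  (const_distinct : forall c c' : fun_symb L 0, c <> c' ->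
     fun_of (A := A) c [tuple] <> fun_of c' [tuple])
  (const_unary : forall (c : fun_symb L 0) (F : fun_symb L 1) (x : A),
     fun_of c [tuple] = [set x] -> fun_of F [tuple x] = set0)
  (orbit_finite : finite_set (relabel_orbit Gam A)) :
  exists B : structure L,
    finite_structure B /\ faithful_coherent_EPPA_witness Gam A B.
Proof.
have [O] := finite_orbit_action orbit_finite.
case: A finA const_singleton {const_distinct} const_unary {orbit_finite} O => V S finV.
have [T eq_V] := @finite_countType V finV.
case: V / eq_V S {finV} => S const_singleton const_unary O.
exact: finite_base_witness arity_le1 const_fixed const_singleton const_unary O.
Qed.
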